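(* Let $\mu$ be a nonzero positive Radon measure on $\mathbb{R}^d$ with compact support, and let $$p_0(\mu)=\inf\{\,1\le p\le\infty \;:\; \mu \text{ satisfies } (RC)_p\,\}.$$ Then for every $p$ with $\max\{2,p_0(\mu)\}<p\le\infty$ there exists a maximizer for $T_\mu$ with respect to $p$. More precisely, for every maximizing sequence $(\hat h_n)_{n\in\mathbb{N}}\subset L^2(d\mu)$ for $T_\mu$ with respect to $p$, there exists a sequence $(x_n)_{n\in\mathbb{N}}$ in $\mathbb{R}^d$ such that the sequence $\big(e^{i x_n\cdot \xi}\,\hat h_n(\xi)\big)_{n\in\mathbb{N}}$ is (relatively) compact in $L^2(d\mu)$.
   Context: Functions are complex valued. For a positive compactly supported Radon (hence finite) measure $\mu$ on $\mathbb{R}^d_\xi$, define the operator $$T_\mu: C^0(\mathrm{supp}\,\mu)\to C^\infty(\mathbb{R}^d_x),\qquad (T_\mu \hat h)(x)=\int e^{i x\cdot\xi}\,\hat h(\xi)\,d\mu(\xi).$$ For Banach spaces $X,Y$, $\mathcal{L}(X,Y)$ denotes the space of continuous linear operators from $X$ to $Y$, with the operator norm. For $p\in[1,\infty]$, the measure $\mu$ satisfies the restriction condition $(RC)_p$ if $T_\mu\in\mathcal{L}(L^2(d\mu),L^p(\mathbb{R}^d_x))$, i.e. $T_\mu$ extends to a bounded linear operator from $L^2(d\mu)$ to $L^p(\mathbb{R}^d)$ (still denoted $T_\mu$). Assume $\mu$ satisfies $(RC)_p$. There is a maximizer for $T_\mu$ with respect to $p$ if there exists $\hat h\in L^2(d\mu)$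 with $\|\hat h\|_{L^2(d\mu)}=1$ and $\|T_\mu\hat h\|_{L^p(\mathbb{R}^d)}=\|T_\mu\|_{\mathcal{L}(L^2(d\mu),L^p(\mathbb{R}^d))}$. A sequence $(\hat h_n)$ in $L^2(d\mu)$ is a maximizing sequence for $T_\mu$ with respect to $p$ if $\|\hat h_n\|_{L^2(d\mu)}=1$ for all $n$ and $\lim_{n\to\infty}\|T_\mu\hat h_n\|_{L^p(\mathbb{R}^d)}=\|T_\mu\|_{\mathcal{L}(L^2(d\mu),L^p(\mathbb{R}^d))}$. A sequence is (relatively) compact in $L^2(d\mu)$ if every subsequence of it has a further subsequence converging in the norm of $L^2(d\mu)$. *)

(* Defs.v *)
From HB Require Import structures.
From mathcomp Require Import all_boot all_order all_algebra.
From mathcomp Require Import all_classical all_reals all_analysis.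
From mathcomp Require Import measurable_realfun complex.
Set Implicit Arguments.
Unset Strict Implicit.
Unset Printing Implicit Defensive.
Import Order.TTheory GRing.Theory Num.Theory.
Import numFieldNormedType.Exports.

Local Open Scope classical_set_scope.
Local Open Scope ring_scope.
Local Open Scope complex_scope.

(* R^d is 'rV[R]_d. Its topology is the library's (induced by the max norm,
   hence the Euclidean one); it is given here its Borel sigma-algebra. *)
Definition borel_mx_display : measure_display.
Proof. exact: default_measure_display. Qed.

HB.instance Definition _ (R : realType) (m n : nat) :=
  @isMeasurable.Build borel_mx_display 'M[R]_(m, n) <<s @open 'M[R]_(m, n) >>
    (@sigma_algebra0 _ setT _) (@sigma_algebraC _ _)
    (@sigma_algebra_bigcup _ setT _).

Section borel_rV.
Context {R : realType}.

Lemma rV_open_measurable n (U : set 'rV[R]_n) : open U -> measurable U.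
Proof. by move=> oU; exact: sub_sigma_algebra. Qed.

Lemma measurable_fun_rV_continuous n (f : 'rV[R]_n -> R) :
  continuous f -> measurable_fun setT f.
Proof.
move=> /continuousP cf; apply: (measurability _ (RGenOpens.measurableE R)).
move=> _ [_ [a [b ->] <-]]; rewrite setTI; apply: rV_open_measurable.
exact/cf/interval_open.
Qed.

Lemma measurable_fun_coord n (j : 'I_n) :
  measurable_fun setT (fun v : 'rV[R]_n => v 0 j).
Proof. by apply: measurable_fun_rV_continuous; exact: coord_continuous. Qed.

Let rbox n (c : 'rV[rat]_n * nat) : set 'rV[R]_n :=
  [set v | forall j, `|ratr (c.1 0 j) - v 0 j| < c.2.+1%:R^-1].

Let open_rbox n (U : set 'rV[R]_n) : open U ->
  U = \bigcup_(c in [set c | rbox c `<=` U]) rbox c.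
Proof.
rewrite openE => oU; apply/seteqP; split => [v Uv|v [c /= cU cv]]; last exact: cU.
have /nbhs_ballP[e /= e0 eU] := oU _ Uv.
have [k ke] : exists k, k.+1%:R^-1 < e / 2.
  have /ltr_add_invr[k] : 0 < e / 2 by rewrite divr_gt0.
  by rewrite add0r; exists k.
have k0 : (0 : R) < k.+1%:R^-1 by rewrite invr_gt0.
have /choice[c cP] j : exists q : rat, `|ratr q - v 0 j| < k.+1%:R^-1.
  have /rat_in_itvoo[q /itvP qP] : v 0 j < v 0 j + k.+1%:R^-1 by rewrite ltrDl.
  by exists q; rewrite gtr0_norm ?subr_gt0 ?qP// ltrBlDl qP.
exists (\row_j c j, k) => /=; last by move=> j; rewrite mxE.
move=> w /= wP; apply: eU; split => // i j; rewrite ord1 /ball/=.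
have := wP j; rewrite mxE /= => wj.
rewrite [e]splitr (le_lt_trans (ler_distD (ratr (c j)) _ _))// ltrD//.
  by rewrite distrC (lt_trans (cP j)).
exact: (lt_trans wj).
Qed.

Lemma measurable_fun_rVP d (T : measurableType d) n (f : T -> 'rV[R]_n) :
  (forall j, measurable_fun setT (fun x => f x 0 j)) -> measurable_fun setT f.
Proof.
move=> mf.
apply: (@measurability _ _ T 'rV[R]_n setT f (@open 'rV[R]_n) erefl).
move=> _ [U oU <-]; rewrite setTI (open_rbox oU) preimage_bigcup.
rewrite bigcup_mkcond; apply: countable_bigcupT_measurable => // c.
case: ifPn => // _.
rewrite (_ : f @^-1` _ = \bigcap_(j in [set: 'I_n])
    ((fun x => f x 0 j) @^-1` ball (ratr (c.1 0 j) : R) c.2.+1%:R^-1)).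
  apply: fin_bigcap_measurable => // j _; rewrite -[X in measurable X]setTI.
  by apply: mf => //; apply: open_measurable; exact: ball_open.
by apply/seteqP; split => [x xP j _|x xP j]; [exact: xP|exact: (xP j I)].
Qed.

Lemma measurable_fun_row_mx n :
  measurable_fun setT
    (fun xv : R * 'rV[R]_n => row_mx xv.1%:M xv.2 : 'rV[R]_(1 + n)).
Proof.
apply: measurable_fun_rVP => j; case: (split_ordP j) => k ->.
  under eq_fun do rewrite row_mxEl ord1 mxE eqxx mulr1n.
  exact: measurable_fst.
under eq_fun do rewrite row_mxEr.
exact: (measurableT_comp (measurable_fun_coord k) measurable_snd).
Qed.

End borel_rV.

Section lebesgue_rV.
Context {R : realType}.

Section step.
Variables (n : nat) (m : {sigma_finite_measure set 'rV[R]_n -> \bar R}).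

Let cons (xv : R * 'rV[R]_n) : 'rV[R]_n.+1 := row_mx xv.1%:M xv.2.

Let uncons (w : 'rV[R]_n.+1) : R * 'rV[R]_n := (w 0 0, @rsubmx _ 1 1 n w).

Let consK : cancel cons uncons.
Proof.
move=> [x v]; rewrite /uncons /cons /= row_mxKr; congr pair.
have := row_mxEl x%:M v 0 0; rewrite [RHS]mxE eqxx mulr1n => {2}<-.
by congr (row_mx _ _ _ _); exact: val_inj.
Qed.

Let measurable_cons : measurable_fun setT cons.
Proof. exact: measurable_fun_row_mx. Qed.

Let measurable_uncons : measurable_fun setT uncons.
Proof.
apply/measurable_fun_pairP; split => /=; first exact: measurable_fun_coord.
apply: measurable_fun_rVP => j /=.
by under eq_fun do rewrite mxE; exact: measurable_fun_coord.
Qed.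

Definition lebesgue_step : set 'rV[R]_n.+1 -> \bar R :=
  pushforward ((@lebesgue_measure R) \x m)%E cons.

Let lebesgue_step0 : lebesgue_step set0 = 0%E.
Proof. by rewrite /lebesgue_step /pushforward preimage_set0 measure0. Qed.

Let lebesgue_step_ge0 A : (0 <= lebesgue_step A)%E.
Proof. exact: measure_ge0. Qed.

Let lebesgue_step_sigma_additive : semi_sigma_additive lebesgue_step.
Proof. exact: measure_semi_sigma_additive. Qed.

HB.instance Definition _ := isMeasure.Build _ _ _ lebesgue_step
  lebesgue_step0 lebesgue_step_ge0 lebesgue_step_sigma_additive.

Let lebesgue_step_sigma_finite : sigma_finite setT lebesgue_step.
Proof.
have /sigma_finiteP[F [FT ndF Foo]] := sigma_finiteT (@lebesgue_measure R).
have /sigma_finiteP[G [GT ndG Goo]] := sigma_finiteT m.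
exists (fun k => uncons @^-1` (F k `*` G k)).
  rewrite -preimage_bigcup (_ : \bigcup_k (F k `*` G k) = setT).
    by rewrite preimage_setT.
  rewrite -subTset => -[x v] _.
  have [k _ Fkx] : (\bigcup_i F i) x by rewrite -FT.
  have [l _ Glv] : (\bigcup_i G i) v by rewrite -GT.
  exists (maxn k l) => //; split => /=.
    by move: x Fkx; exact/subsetPset/ndF/leq_maxl.
  by move: v Glv; exact/subsetPset/ndG/leq_maxr.
move=> k; have [[mFk Fkoo] [mGk Gkoo]] := (Foo k, Goo k).
have mFG := measurableX mFk mGk; split.
  by rewrite -[X in measurable X]setTI; exact: measurable_uncons.
rewrite /lebesgue_step /pushforward -comp_preimage.
rewrite (_ : uncons \o cons = id); last by apply/funext => xv; exact: consK.
by rewrite preimage_id product_measure1E// lte_mul_pinfty// ge0_fin_numE.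
Qed.

HB.instance Definition _ := Measure_isSigmaFinite.Build _ _ _ lebesgue_step
  lebesgue_step_sigma_finite.

End step.

(* Lebesgue measure on R^n: Dirac mass on R^0, and product with the
   one-dimensional Lebesgue measure, carried over by R * R^n ~ R^(n+1). *)
Fixpoint lebesgue_rV (n : nat) : {sigma_finite_measure set 'rV[R]_n -> \bar R} :=
  match n with
  | 0 => @dirac _ 'rV[R]_0 0 R
  | n'.+1 => lebesgue_step (lebesgue_rV n')
  end.

End lebesgue_rV.
Arguments lebesgue_rV R n : clear implicits.

Lemma measurable_rV_box (R : realType) n (a b : 'rV[R]_n) :
  measurable [set v : 'rV[R]_n | forall j, a 0 j <= v 0 j <= b 0 j].
Proof.
rewrite (_ : mkset _ = \bigcap_(j in [set: 'I_n])
    ((fun v : 'rV[R]_n => v 0 j) @^-1` `[a 0 j, b 0 j])).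
  apply: fin_bigcap_measurable => // j _; rewrite -[X in measurable X]setTI.
  by apply: measurable_fun_coord => //; exact: measurable_itv.
apply/seteqP; split => [v vab j _|v vab j] /=.
  by rewrite in_itv/=; exact: vab.
by have := vab j I; rewrite /= in_itv.
Qed.

Lemma lebesgue_rV_box (R : realType) n (a b : 'rV[R]_n) :
  (forall j, a 0 j <= b 0 j) ->
  lebesgue_rV R n [set v : 'rV[R]_n | forall j, a 0 j <= v 0 j <= b 0 j] =
  (\prod_(j < n) (b 0 j - a 0 j))%:E.
Proof.
elim: n a b => [|n IHn] a b ab.
  by rewrite big_ord0 /= diracE mem_set//= => -[].
pose a' : 'rV[R]_n := \row_j a 0 (lift ord0 j).
pose b' : 'rV[R]_n := \row_j b 0 (lift ord0 j).
rewrite big_ord_recl /= /lebesgue_step /pushforward.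
set P := (X in product_measure1 _ _ X).
have -> : P = `[a 0 ord0, b 0 ord0] `*`
    [set v : 'rV[R]_n | forall j, a' 0 j <= v 0 j <= b' 0 j]; last first.
  rewrite product_measure1E//; last exact: measurable_rV_box.
  rewrite IHn; last by move=> j; rewrite !mxE.
  rewrite EFinM; congr (_ * _)%E.
    rewrite [LHS](lebesgue_measure_itv `[a 0 ord0, b 0 ord0])/= lte_fin.
    by have := ab ord0; rewrite le_eqVlt => /predU1P[->|->//]; rewrite ltxx subrr.
  by congr EFin; apply: eq_bigr => j _; rewrite !mxE.
have E0 (x : R) (v : 'rV[R]_n) : (row_mx x%:M v : 'rV_n.+1) 0 ord0 = x.
  have := row_mxEl (x%:M : 'M[R]_1) v 0 0; rewrite [RHS]mxE eqxx mulr1n => {2}<-.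
  by congr (row_mx _ _ _ _); exact: val_inj.
have ES (x : R) (v : 'rV[R]_n) j : (row_mx x%:M v : 'rV_n.+1) 0 (lift ord0 j) = v 0 j.
  have := row_mxEr (x%:M : 'M[R]_1) v 0 j => <-.
  by congr (row_mx _ _ _ _); exact: val_inj.
apply/seteqP; split => [[x v] /= xv|[x v] /= [x0 vj] j].
  split; first by have := xv ord0; rewrite E0 in_itv.
  by move=> j; have := xv (lift ord0 j); rewrite ES !mxE.
case: (unliftP ord0 j) => [k|] ->; first by have := vj k; rewrite ES !mxE.
by rewrite E0; move: x0; rewrite in_itv.
Qed.

Section complex_functions.
Context d (T : measurableType d) {R : realType}.
Variable m : {measure set T -> \bar R}.
Implicit Types (p : \bar R) (f g : T -> R[i]).

Definition cmeasurable f :=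
  measurable_fun setT (fun x => complex.Re (f x)) /\
  measurable_fun setT (fun x => complex.Im (f x)).

Definition cintegral f : R[i] :=
  (\int[m]_x complex.Re (f x)) +i* (\int[m]_x complex.Im (f x)).

Definition cLnorm p f : \bar R :=
  Lnorm m p (fun x => (ComplexField.Normc.normc (f x))%:E).

(* Representatives of the elements of the complex space L^p(m). *)
Definition cLfun p f := cmeasurable f /\ (cLnorm p f < +oo)%E.

Definition relatively_compact_seq p (u : nat -> T -> R[i]) :=
  forall phi : nat -> nat, {homo phi : j k / (j < k)%N} ->
  exists2 psi : nat -> nat, {homo psi : j k / (j < k)%N} &
  exists2 f, cLfun p f &
    (fun k => cLnorm p (fun x => u (phi (psi k)) x - f x)) @ \oo --> 0%E.

End complex_functions.

Section bounded_operators.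
Context d1 d2 (X : measurableType d1) (Y : measurableType d2) {R : realType}.
Variables (m1 : {measure set X -> \bar R}) (p1 : \bar R).
Variables (m2 : {measure set Y -> \bar R}) (p2 : \bar R).
Implicit Type S : (X -> R[i]) -> (Y -> R[i]).

(* S is an element of L(L^{p1}(m1), L^{p2}(m2)), acting on representatives.
   Additivity up to null sets and boundedness make it compatible with
   almost everywhere equality. *)
Definition bounded_linear S :=
  [/\ forall f, cLfun m1 p1 f -> cLfun m2 p2 (S f),
      forall (a : R[i]) f g, cLfun m1 p1 f -> cLfun m1 p1 g ->
        S (fun x => a * f x + g x) = (fun y => a * S f y + S g y) %[ae m2] &
      exists C : R, forall f, cLfun m1 p1 f ->
        (cLnorm m2 p2 (S f) <= C%:E * cLnorm m1 p1 f)%E].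

Definition opnorm S : \bar R :=
  ereal_sup [set cLnorm m2 p2 (S f) | f in
    [set f | cLfun m1 p1 f /\ (cLnorm m1 p1 f <= 1)%E]].

End bounded_operators.

Section restriction.
Context {R : realType} {d : nat}.
Variable mu : {measure set 'rV[R]_d -> \bar R}.
Implicit Types (p : \bar R) (x xi : 'rV[R]_d) (h : 'rV[R]_d -> R[i])
  (S : ('rV[R]_d -> R[i]) -> ('rV[R]_d -> R[i])).

Definition radon :=
  (forall K, compact K -> (mu K < +oo)%E) /\
  (forall A, measurable A ->
    mu A = ereal_sup [set mu K | K in [set K | compact K /\ K `<=` A]]).

Definition msupport : set 'rV[R]_d :=
  [set x | forall U, open U -> U x -> (0 < mu U)%E].

Definition dotrv x xi : R := \sum_(j < d) x 0 j * xi 0 j.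

Definition expi (t : R) : R[i] := cos t +i* sin t.

Definition Tmu h x : R[i] := cintegral mu (fun xi => expi (dotrv x xi) * h xi).

(* Only the values on the support are constrained: measurability of the whole
   function is required separately, the complement being mu-null. *)
Definition continuous_on_support h :=
  {within msupport, continuous (fun xi => complex.Re (h xi))} /\
  {within msupport, continuous (fun xi => complex.Im (h xi))}.

(* S is the bounded extension L^2(mu) -> L^p(R^d) of Tmu, initially defined on
   C^0(supp mu). *)
Definition bounded_extension p S :=
  bounded_linear mu 2%:E (lebesgue_rV R d) p S /\
  forall h, cLfun mu 2%:E h -> continuous_on_support h ->
    S h = Tmu h %[ae lebesgue_rV R d].

Definition restriction_condition p := exists S, bounded_extension p S.

Definition critical_exponent : \bar R :=
  ereal_inf [set p | (1 <= p)%E /\ restriction_condition p].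

Definition Tnorm p S : \bar R := opnorm mu 2%:E (lebesgue_rV R d) p S.

Definition maximizer p S h :=
  [/\ cLfun mu 2%:E h, cLnorm mu 2%:E h = 1%E &
      cLnorm (lebesgue_rV R d) p (S h) = Tnorm p S].

Definition maximizing_seq p S (h_ : nat -> 'rV[R]_d -> R[i]) :=
  (forall n, cLfun mu 2%:E (h_ n) /\ cLnorm mu 2%:E (h_ n) = 1%E) /\
  (fun n => cLnorm (lebesgue_rV R d) p (S (h_ n))) @ \oo --> Tnorm p S.

End restriction.

(* Main.v *)
Require Import Defs.
From HB Require Import structures.
From mathcomp Require Import all_boot all_order all_algebra.
From mathcomp Require Import all_classical all_reals all_analysis.
From mathcomp Require Import measurable_realfun complex.
From mathcomp Require Import ess_sup_inf ring lra.

(** The measure is finite and carried by a bounded set, so T maps L^2(mu) into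
    bounded, uniformly Lipschitz functions.  With (RC)_q for some q < p this
    has two consequences.  Interpolating between L^q and L^oo bounds T in L^p;
    and, since |T h|^p <= (sup |T h|)^(p-q) |T h|^q, functions T h_n that are
    bounded in L^q and do not tend to 0 in L^p cannot tend to 0 uniformly
    ([Tsup_lower_bound]).

    Multiplying h by a character translates T h and changes no norm
    ([Tmu_modulate], [energy_translate], [nsq_modulate]).  Given a maximizing
    sequence, modulate h_n so that |T h_n| is nearly maximal at the origin, and
    let g be a weak limit of the modulated sequence g_n.  Each value T h (x) is
    the pairing of h with a character, so T g_n -> T g at every point; at the
    origin this gives T g (0) <> 0, whence g <> 0.

    The weak limit in fact carries all the mass.  Let M be the norm of T and
    a = |g|^2.  Orthogonality gives |g_n - g|^2 -> 1 - a, and the Brezis-Lieb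
    inequality ([brezis_lieb_le]) gives
      |T g_n|_p^p <= (1 + o(1)) |T (g_n - g)|_p^p + |T g|_p^p + o(1),
    so that M^p <= M^p ((1 - a)^(p/2) + a^(p/2)).  Since p > 2 and a > 0, this
    forces a = 1 and |T g|_p = M ([no_splitting], [weak_limit_full]): the
    convergence of g_n to g is strong and g is a maximizer.  For p = oo the
    supremum of |T h_n| is the norm itself, so |T g (0)| >= M already gives
    |g| = 1.  Both cases end in [concentration].

    Weak limits are taken along an ultrafilter on the indices: bounded real
    sequences converge along it, so f |-> lim <g_n, f> is defined at once on
    all of L^2(mu) and is represented by an element of it ([riesz_L2],
    [weak_ultralimit]).  A genuine subsequence is extracted when only countably
    many conditions are left ([ultra_extract]).  The real scalar product
    Re <f, g> is enough throughout: the real and imaginary parts of T h (x) are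
    the pairings of h with two unimodular functions.

    Finally, a bounded extension S is prescribed only on continuous functions.
    These are dense in L^2(mu) ([continuous_dense_L2]), and h_j -> h in L^2(mu)
    makes T h_j converge pointwise and S h_j converge in L^p, so S h = T h
    almost everywhere ([extension_ae]); all statements about S are thereby
    statements about the integral T. *)

Set Implicit Arguments.
Unset Strict Implicit.
Unset Printing Implicit Defensive.
Import Order.TTheory GRing.Theory Num.Theory.
Import numFieldNormedType.Exports.

Local Open Scope classical_set_scope.
Local Open Scope ring_scope.

(** * The real scalar product on complex functions *)

Section complex_pairing.
Context {R : realType}.
Implicit Types (z w : R[i]) (a : R).

(** The real part of z times the conjugate of w. *)
Definition cdot z w : R := complex.Re z * complex.Re w + complex.Im z * complex.Im w.

Lemma cReD z w : complex.Re (z + w) = complex.Re z + complex.Re w.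
Proof. by case: z; case: w. Qed.

Lemma cImD z w : complex.Im (z + w) = complex.Im z + complex.Im w.
Proof. by case: z; case: w. Qed.

Lemma cReB z w : complex.Re (z - w) = complex.Re z - complex.Re w.
Proof. by case: z; case: w. Qed.

Lemma cImB z w : complex.Im (z - w) = complex.Im z - complex.Im w.
Proof. by case: z; case: w. Qed.

Lemma cReM z w : complex.Re (z * w) =
  complex.Re z * complex.Re w - complex.Im z * complex.Im w.
Proof. by case: z; case: w. Qed.

Lemma cImM z w : complex.Im (z * w) =
  complex.Re z * complex.Im w + complex.Im z * complex.Re w.
Proof. by case: z; case: w. Qed.

Lemma cReZ a z : complex.Re (a%:C%C * z) = a * complex.Re z.
Proof. by rewrite cReM/= mul0r subr0. Qed.

Lemma cImZ a z : complex.Im (a%:C%C * z) = a * complex.Im z.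
Proof. by rewrite cImM/= mul0r addr0. Qed.

Lemma cdotC z w : cdot z w = cdot w z.
Proof. by rewrite /cdot; ring. Qed.

Lemma cdotDl z1 z2 w : cdot (z1 + z2) w = cdot z1 w + cdot z2 w.
Proof. by rewrite /cdot cReD cImD; ring. Qed.

Lemma cdotZl a z w : cdot (a%:C%C * z) w = a * cdot z w.
Proof. by rewrite /cdot cReZ cImZ; ring. Qed.

Lemma cdot_ge0 z : 0 <= cdot z z.
Proof. by rewrite /cdot -!expr2 addr_ge0// sqr_ge0. Qed.

Lemma cdotM u z w : cdot (u * z) (u * w) = cdot u u * cdot z w.
Proof. by rewrite /cdot !cReM !cImM; ring. Qed.

Lemma normc_cdot z : ComplexField.Normc.normc z = Num.sqrt (cdot z z).
Proof. by case: z => a b; rewrite /= /cdot/= !expr2. Qed.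

Lemma normc2_cdot z : ComplexField.Normc.normc z ^+ 2 = cdot z z.
Proof. by rewrite normc_cdot sqr_sqrtr// cdot_ge0. Qed.

Lemma cdot_le z w : `|cdot z w| <= cdot z z + cdot w w.
Proof.
case: z w => [a b] [c e]; rewrite ler_norml /cdot/=.
have := (sqr_ge0 (a + c), sqr_ge0 (a - c), sqr_ge0 (b + e), sqr_ge0 (b - e)).
have := (sqr_ge0 a, sqr_ge0 b, sqr_ge0 c, sqr_ge0 e).
rewrite !expr2 => -[[[h1 h2] h3] h4] [[[h5 h6] h7] h8].
by apply/andP; split; nra.
Qed.

Lemma cdotD_le z w : cdot (z + w) (z + w) <= 2 * (cdot z z + cdot w w).
Proof.
have := cdot_ge0 (z - w).
by case: z w => [a b] [c e]; rewrite /cdot/=; lra.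
Qed.

End complex_pairing.

Section measurability.
Context d (T : measurableType d) {R : realType}.
Implicit Types f g : T -> R[i].

Lemma cmeasurableD f g : cmeasurable f -> cmeasurable g ->
  cmeasurable (fun x => f x + g x).
Proof.
move=> [fr fi] [gr gi]; split.
  by under eq_fun do rewrite cReD; exact: measurable_funD.
by under eq_fun do rewrite cImD; exact: measurable_funD.
Qed.

Lemma cmeasurableM f g : cmeasurable f -> cmeasurable g ->
  cmeasurable (fun x => f x * g x).
Proof.
move=> [fr fi] [gr gi]; split.
  by under eq_fun do rewrite cReM; apply: measurable_funB; exact: measurable_funM.
by under eq_fun do rewrite cImM; apply: measurable_funD; exact: measurable_funM.
Qed.

Lemma cmeasurable_cst (z : R[i]) : cmeasurable (fun _ : T => z).
Proof. by split. Qed.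

Lemma cmeasurableB f g : cmeasurable f -> cmeasurable g ->
  cmeasurable (fun x => f x - g x).
Proof.
move=> [fr fi] [gr gi]; split.
  by under eq_fun do rewrite cReB; exact: measurable_funB.
by under eq_fun do rewrite cImB; exact: measurable_funB.
Qed.

Lemma measurable_cdot f g : cmeasurable f -> cmeasurable g ->
  measurable_fun setT (fun x => cdot (f x) (g x)).
Proof.
by move=> [fr fi] [gr gi]; apply: measurable_funD; exact: measurable_funM.
Qed.

Lemma measurable_normc f : cmeasurable f ->
  measurable_fun setT (fun x => ComplexField.Normc.normc (f x)).
Proof.
move=> mf; under eq_fun do rewrite normc_cdot.
have msqrt : measurable_fun setT (@Num.sqrt R).
  by apply: continuous_measurable_fun; exact: sqrt_continuous.
exact: (measurableT_comp msqrt (measurable_cdot mf mf)).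
Qed.

End measurability.

Section L2.
Context d (T : measurableType d) {R : realType}.
Variable m : {measure set T -> \bar R}.
Implicit Types f g h : T -> R[i].

Definition L2 f := cmeasurable f /\
  m.-integrable setT (fun x => (cdot (f x) (f x))%:E).

Definition dot f g : R := \int[m]_x cdot (f x) (g x).

Lemma dot_integrable f g : L2 f -> L2 g ->
  m.-integrable setT (fun x => (cdot (f x) (g x))%:E).
Proof.
move=> [mf f2] [mg g2]; apply: le_integrable (integrableD measurableT f2 g2) => //.
  exact/measurable_EFinP/measurable_cdot.
move=> x _ /=; rewrite lee_fin (le_trans (cdot_le _ _))//.
by rewrite ger0_norm// addr_ge0// cdot_ge0.
Qed.

Lemma L2D f g : L2 f -> L2 g -> L2 (fun x => f x + g x).
Proof.
move=> Lf Lg; have [[mf f2] [mg g2]] := (Lf, Lg).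
have mfg := cmeasurableD mf mg; split=> //.
apply: le_integrable (integrableZl measurableT 2 (integrableD measurableT f2 g2)) => //.
  exact/measurable_EFinP/measurable_cdot.
move=> x _ /=; rewrite lee_fin !ger0_norm ?cdot_ge0//.
  exact: cdotD_le.
by rewrite mulr_ge0// addr_ge0// cdot_ge0.
Qed.

Lemma L2Z (a : R) f : L2 f -> L2 (fun x => a%:C%C * f x).
Proof.
move=> [mf f2]; split; first exact/cmeasurableM/mf/cmeasurable_cst.
under eq_fun do rewrite cdotZl cdotC cdotZl !EFinM.
by do 2 apply: integrableZl => //.
Qed.

Lemma eq_L2 f g : f =1 g -> L2 f -> L2 g.
Proof. by move=> /funext ->. Qed.

Lemma L2B f g : L2 f -> L2 g -> L2 (fun x => f x - g x).
Proof.
move=> Lf Lg; apply: eq_L2 (L2D Lf (L2Z (-1) Lg)) => x.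
by apply/eqP; rewrite eq_complex cReD cImD cReZ cImZ cReB cImB !mulN1r !eqxx.
Qed.

Lemma L2_0 : L2 (fun=> 0).
Proof.
split; first exact: cmeasurable_cst.
rewrite (_ : (fun _ => _) = cst 0%E); first exact: integrable0.
by apply/funext => x; rewrite /cdot/= mul0r addr0.
Qed.

Lemma dotC f g : dot f g = dot g f.
Proof. by apply: eq_Rintegral => x _; exact: cdotC. Qed.

Lemma dotDl f1 f2 g : L2 f1 -> L2 f2 -> L2 g ->
  dot (fun x => f1 x + f2 x) g = dot f1 g + dot f2 g.
Proof.
move=> L1 L2 Lg; rewrite /dot -RintegralD//; try exact: dot_integrable.
by apply: eq_Rintegral => x _; exact: cdotDl.
Qed.

Lemma dotZl (a : R) f g : L2 f -> L2 g ->
  dot (fun x => a%:C%C * f x) g = a * dot f g.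
Proof.
move=> Lf Lg; rewrite /dot -RintegralZl//; try exact: dot_integrable.
by apply: eq_Rintegral => x _; exact: cdotZl.
Qed.

Lemma dotBl f1 f2 g : L2 f1 -> L2 f2 -> L2 g ->
  dot (fun x => f1 x - f2 x) g = dot f1 g - dot f2 g.
Proof.
move=> L1 L2 Lg; rewrite /dot -RintegralB//; try exact: dot_integrable.
by apply: eq_Rintegral => x _; rewrite /cdot cReB cImB; ring.
Qed.

Lemma dotDr f g1 g2 : L2 f -> L2 g1 -> L2 g2 ->
  dot f (fun x => g1 x + g2 x) = dot f g1 + dot f g2.
Proof. by move=> ? ? ?; rewrite dotC dotDl// dotC (dotC g2). Qed.

Lemma dotZr (a : R) f g : L2 f -> L2 g ->
  dot f (fun x => a%:C%C * g x) = a * dot f g.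
Proof. by move=> ? ?; rewrite dotC dotZl// dotC. Qed.

Lemma dotBr f g1 g2 : L2 f -> L2 g1 -> L2 g2 ->
  dot f (fun x => g1 x - g2 x) = dot f g1 - dot f g2.
Proof. by move=> ? ? ?; rewrite dotC dotBl// dotC (dotC g2). Qed.

Definition nsq f := dot f f.

Lemma nsq_ge0 f : 0 <= nsq f.
Proof. by apply: Rintegral_ge0 => x _; exact: cdot_ge0. Qed.

Lemma nsqZ (a : R) f : L2 f -> nsq (fun x => a%:C%C * f x) = a ^+ 2 * nsq f.
Proof.
by move=> Lf; rewrite /nsq dotZl// ?dotZr// ?expr2 ?mulrA//; exact: L2Z.
Qed.

Lemma nsqD f g : L2 f -> L2 g ->
  nsq (fun x => f x + g x) = nsq f + 2 * dot f g + nsq g.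
Proof.
move=> Lf Lg; have Lfg := L2D Lf Lg.
by rewrite /nsq dotDl// !dotDr// (dotC g f); ring.
Qed.

Lemma nsqB f g : L2 f -> L2 g ->
  nsq (fun x => f x - g x) = nsq f - 2 * dot f g + nsq g.
Proof.
move=> Lf Lg; have Lfg := L2B Lf Lg.
by rewrite /nsq dotBl// !dotBr// (dotC g f); ring.
Qed.

(** The discriminant criterion, for every sign of the leading coefficient: it
    yields Cauchy-Schwarz and the Euler equation of a minimisation problem. *)
Lemma quadratic_ge0 (a b c : R) :
  (forall t, 0 <= a + 2 * t * b + t ^+ 2 * c) -> b ^+ 2 <= a * c.
Proof.
move=> H; have a0 : 0 <= a by have := H 0; rewrite expr0n/= !(mulr0,mul0r,addr0).
have [c0|c0|c0] := ltgtP c 0.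
(* For c < 0 the hypothesis fails for large |t|: at these two values of t
   the cross terms cancel and leave a contradiction. *)
- have := H (- (b ^+ 2 + a + 1 - c) / c).
  have cN : c != 0 by rewrite lt_eqF.
  have := H ((b ^+ 2 + a + 1 - c) / c).
  rewrite !expr2; set k := (b * b + a + 1 - c).
  have -> : a + 2 * (k / c) * b + k / c * (k / c) * c = a + 2 * b * k / c + k * k / c.
    by field.
  have -> : a + 2 * (- k / c) * b + - k / c * (- k / c) * c = a - 2 * b * k / c + k * k / c.
    by field.
  move=> h1 h2.
  have : 0 <= a + k * k / c by lra.
  rewrite -(ler_nM2r c0) mul0r mulrDl divfK// => h3.
  have : k <= k * k + a * c by rewrite /k in h3 *; nra.
  by rewrite /k in h3 * => h4; nra.
(* For c > 0, the minimum of the quadratic polynomial. *)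
- have := H (- b / c); have cN : c != 0 by rewrite gt_eqF.
  rewrite -(ler_pM2r c0) mul0r !expr2.
  have -> : (a + 2 * (- b / c) * b + - b / c * (- b / c) * c) * c = a * c - b * b by field.
  by rewrite subr_ge0.
- subst c; rewrite mulr0.
  have [->|b0] := eqVneq b 0; first by rewrite expr0n.
  (* For c = 0 and b <> 0 the affine function takes the value -1 here. *)
  have := H (- (a + 1) / (2 * b)).
  have -> : a + 2 * (- (a + 1) / (2 * b)) * b + (- (a + 1) / (2 * b)) ^+ 2 * 0 = - 1.
    by field.
  lra.
Qed.

Lemma dot_CS f g : L2 f -> L2 g -> dot f g ^+ 2 <= nsq f * nsq g.
Proof.
move=> Lf Lg; apply: quadratic_ge0 => t.
have := nsq_ge0 (fun x => f x + t%:C%C * g x).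
by rewrite nsqD// ?nsqZ// ?dotZr ?mulrA//; exact: L2Z.
Qed.

Lemma nsqD_le f g : L2 f -> L2 g ->
  nsq (fun x => f x + g x) <= 2 * (nsq f + nsq g).
Proof.
move=> Lf Lg; rewrite nsqD//.
have := nsq_ge0 (fun x => f x - g x); rewrite nsqB//; lra.
Qed.

Lemma nsq_eq f g : f =1 g -> nsq f = nsq g.
Proof. by move=> /funext ->. Qed.

End L2.

Section L2_Lnorm.
Context d (T : measurableType d) {R : realType}.
Variable m : {measure set T -> \bar R}.
Implicit Types f g h : T -> R[i].
Local Open Scope ereal_scope.

Lemma integral_normc2 f :
  \int[m]_x (`|(ComplexField.Normc.normc (f x))%:E| `^ 2) =
  \int[m]_x (cdot (f x) (f x))%:E.
Proof.
apply: eq_integral => x _; rewrite abse_EFin poweR_EFin powR_mulrn// real_normK ?num_real//.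
by rewrite normc2_cdot.
Qed.

Lemma L2_cLfunP f : L2 m f <-> cLfun m 2%:E f.
Proof.
rewrite /L2 /cLfun /cLnorm; split => -[mf h]; split => //.
  rewrite unlock integral_normc2 poweR_lty//.
  exact: (integrable_lty measurableT).
apply/integrableP; split; first exact/measurable_EFinP/measurable_cdot.
under eq_integral do rewrite /= ger0_norm ?cdot_ge0//.
by rewrite -integral_normc2; move: h; rewrite unlock => /lty_poweRy; apply; rewrite invr_eq0.
Qed.

Lemma cLnorm2 f : L2 m f -> cLnorm m 2%:E f = (Num.sqrt (nsq m f))%:E.
Proof.
move=> [mf f2]; rewrite /cLnorm unlock integral_normc2.
rewrite poweR12_sqrt; last by apply: integral_ge0 => x _; rewrite lee_fin cdot_ge0.
by rewrite /nsq /dot /Rintegral -[X in sqrte X]fineK//; exact: (integrable_fin_num measurableT).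
Qed.

End L2_Lnorm.

(** * Completeness of L^2 and the Riesz representation *)

Section fatou_bound.
Context d (T : measurableType d) {R : realType}.
Variable m : {measure set T -> \bar R}.
Local Open Scope ereal_scope.

Lemma cvg_EFin_seq (u : nat -> R) (l : R) :
  u n @[n --> \oo] --> l -> (u n)%:E @[n --> \oo] --> l%:E.
Proof. by move=> ul; apply: cvg_EFin => //; exact: nearW. Qed.

Lemma limn_einf_le (u : (\bar R)^nat) (B : \bar R) :
  (\forall n \near \oo, u n <= B) -> limn_einf u <= B.
Proof.
move=> uB; rewrite limn_einf_lim; apply: lime_le; first exact: is_cvg_einfs.
near=> n; apply: (@le_trans _ _ (u n)); last by near: n.
by apply: ereal_inf_lbound; exists n => /=.
Unshelve. all: by end_near. Qed.

(** Fatou's lemma for real functions in the form used below: it transfers an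
    eventual bound on the integrals to the limit. *)
Lemma fatou_le (F_ : nat -> T -> R) (F : T -> R) (B : \bar R) :
  (forall n, measurable_fun setT (F_ n)) -> measurable_fun setT F ->
  (forall n x, 0 <= F_ n x)%R -> (forall x, 0 <= F x)%R ->
  {ae m, forall x, F_ n x @[n --> \oo] --> F x} ->
  (\forall n \near \oo, \int[m]_x (F_ n x)%:E <= B) ->
  \int[m]_x (F x)%:E <= B.
Proof.
move=> mF_ mF F_0 F0 F_F FB.
have mEF_ n : measurable_fun setT (fun x => (F_ n x)%:E) by exact/measurable_EFinP.
rewrite (@ge0_ae_eq_integral _ _ _ _ _ (fun x => (F x)%:E)
    (fun x => limn_einf (fun n => (F_ n x)%:E))) //.
- apply: le_trans (limn_einf_le FB); apply: fatou => // n x _.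
  by rewrite lee_fin.
- exact/measurable_EFinP.
- suff ml : measurable_fun setT (fun x => limn_esup (fun n => - (F_ n x)%:E)).
    exact: (measurableT_comp (f := -%E) _ ml).
  apply: measurable_fun_limn_esup => n.
  exact: (measurableT_comp (f := -%E) _ (mEF_ n)).
- by move=> x _; rewrite lee_fin.
- move=> x _; rewrite limn_einf_lim; apply: lime_ge; first exact: is_cvg_einfs.
  by near=> n; apply: le_ereal_inf_tmp => _ [k /= _ <-]; rewrite lee_fin.
- apply: filterS F_F => x Fx _; apply/esym.
  by have [-> _] := cvg_limn_einf_sup (cvg_EFin_seq Fx).
Unshelve. all: by end_near. Qed.

End fatou_bound.

Section L2_complete.
Context d (T : measurableType d) {R : realType}.
Variable m : {measure set T -> \bar R}.
Hypothesis mfin : (m setT < +oo)%E.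

Lemma nsqE f : L2 m f -> (nsq m f)%:E = (\int[m]_x (cdot (f x) (f x))%:E)%E.
Proof.
by move=> [_ fi]; rewrite /nsq/dot/Rintegral fineK//; exact: (integrable_fin_num measurableT).
Qed.

(** The sum of the integrals is finite, so the sum of the functions is
    integrable, hence finite almost everywhere. *)
Lemma ae_summable (D : nat -> T -> R) (c : R) :
  (forall n, measurable_fun setT (D n)) -> (forall n x, 0 <= D n x) ->
  (forall n, (\int[m]_x (D n x)%:E <= (c / (2 ^ n.+1)%:R)%:E)%E) ->
  {ae m, forall x, cvgn (series (D ^~ x))}.
Proof.
move=> mD D0 Dc.
have c0 : 0 <= c.
  have : (0 <= (c / (2 ^ 1)%:R)%:E)%E.
    by apply: le_trans (Dc 0%N); apply: integral_ge0 => x _; rewrite lee_fin.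
  by rewrite lee_fin pmulr_lge0.
have mED n : measurable_fun setT (fun x => (D n x)%:E) by exact/measurable_EFinP.
have E0 n x : setT x -> (0 <= (D n x)%:E)%E by rewrite lee_fin.
have Sint : m.-integrable setT (fun x => \sum_(n <oo) (D n x)%:E)%E.
  apply/integrableP; split.
    by apply: ge0_emeasurable_sum => // n x _ _; exact: E0.
  under eq_integral.
    move=> x _; rewrite gee0_abs; last by apply: nneseries_ge0 => n _ _; exact: E0.
    over.
  rewrite integral_nneseries//.
  apply: (@le_lt_trans _ _ (c%:E)); last exact: ltry.
  have := @cvg_geometric_eseries_half R c 0; rewrite expr0 divr1.
  rewrite (_ : (fun k => _) = (fun k => (c / (2 ^ k.+1)%:R)%:E)); last first.
    by apply/funext => k; rewrite addn1.
  move=> /cvg_lim <-//; apply: lee_nneseries => // n _ _.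
  by apply: integral_ge0 => x _; exact: E0.
have := integrable_ae measurableT Sint; apply: filterS => x /(_ I) xfin.
apply: nondecreasing_is_cvgn.
  by apply/nondecreasing_seqP => n; rewrite /series/= big_nat_recr//= lerDl.
exists (fine (\sum_(n <oo) (D n x)%:E)%E) => _ [n _ <-].
rewrite -lee_fin fineK// /series/= -sumEFin.
by apply: nneseries_lim_ge => // k _ _; exact: E0.
Qed.

Lemma cvg_of_summable_incr (u D : nat -> R) :
  (forall n, `|u n.+1 - u n| <= D n) -> (forall n, 0 <= D n) ->
  cvgn (series D) -> cvgn u.
Proof.
move=> uD D0 cD.
have : cvgn (series (telescope u)).
  by apply: normed_cvg; apply: series_le_cvg cD => // n; exact: normr_ge0.
rewrite telescopeK => cu; have -> : u = (fun n => (u n - u 0%N) + u 0%N).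
  by apply/funext => n; rewrite subrK.
by apply: is_cvgD => //; exact: is_cvg_cst.
Qed.

(** Arithmetic-geometric mean, with a weight: the increments of a sequence that
    is Cauchy in L^2 are dominated by functions whose integrals are summable. *)
Lemma norm_le_sqr (p a b : R) : 0 < p -> `|a| <= p * (a * a + b * b) + p^-1.
Proof.
move=> p0; rewrite -(ler_pM2l p0) mulrDr divff ?gt_eqF//.
have := sqr_ge0 (p * `|a| - 1); have h2 := sqr_ge0 (p * b).
have -> : a * a = `|a| ^+ 2 by rewrite -expr2 real_normK ?num_real.
have := mulr_ge0 (ltW p0) (normr_ge0 a); move: h2; rewrite !expr2; nra.
Qed.

(** The upper limit is measurable on the whole space, also where the sequence
    diverges, and so provides a limit function everywhere. *)
Lemma measurable_limn_esup_fine (u : nat -> T -> R) :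
  (forall n, measurable_fun setT (u n)) ->
  measurable_fun setT (fun x => fine (limn_esup (fun n => (u n x)%:E))).
Proof.
move=> mu; have h : measurable_fun setT (fun x => limn_esup (fun n => (u n x)%:E)).
  by apply: measurable_fun_limn_esup => n; exact/measurable_EFinP.
exact: (measurableT_comp (f := fine) _ h).
Qed.

(** The Riesz-Fischer argument: geometric decay makes the increments summable
    almost everywhere, and Fatou bounds the distance to the pointwise limit. *)
Lemma L2_fast_cauchy (f_ : nat -> T -> R[i]) :
  (forall n, L2 m (f_ n)) ->
  (forall n k, (n <= k)%N -> nsq m (fun x => f_ k x - f_ n x) <= (4^-1) ^+ n) ->
  exists2 f, L2 m f & forall n, nsq m (fun x => f x - f_ n x) <= (4^-1) ^+ n.
Proof.
move=> Lf fC.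
pose del n x := f_ n.+1 x - f_ n x.
(* The weight 2^n balances the decay 4^-n of the squares against the constant
   term; both integrals are of order 2^-n. *)
pose D n x : R := 2 ^+ n * cdot (del n x) (del n x) + (2 ^+ n)^-1.
have Ldel n : L2 m (del n) by exact: L2B.
have p2 n : 0 < 2 ^+ n :> R by rewrite exprn_gt0.
have D0 n x : 0 <= D n x by rewrite addr_ge0 ?mulr_ge0 ?cdot_ge0 ?invr_ge0 ?(ltW (p2 _)).
have mD n : measurable_fun setT (D n).
  by apply: measurable_funD => //; apply: measurable_funM => //;
    apply: measurable_cdot; case: (Ldel n).
have ReD_ n x : `|complex.Re (f_ n.+1 x) - complex.Re (f_ n x)| <= D n x.
  by rewrite -cReB; exact: norm_le_sqr.
have ImD_ n x : `|complex.Im (f_ n.+1 x) - complex.Im (f_ n x)| <= D n x.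
  by rewrite -cImB /D /cdot addrC -/(del n x) [X in _ * X]addrC addrC; exact: norm_le_sqr.
have Dint n : (\int[m]_x (D n x)%:E <=
    (2 * (1 + fine (m setT)) / (2 ^ n.+1)%:R)%:E)%E.
  have [_ i1] := Ldel n.
  under eq_integral do rewrite /D EFinD EFinM.
  rewrite ge0_integralD//=; last 2 first.
  - by move=> x _; rewrite lee_fin mulr_ge0 ?cdot_ge0// ltW.
  - apply/measurable_EFinP/measurable_funM => //.
    by apply: measurable_cdot; case: (Ldel n).
  rewrite integralZl// -nsqE// integral_cst//.
  rewrite -[m setT]fineK ?ge0_fin_numE// -!EFinM -EFinD lee_fin.
  have h : nsq m (del n) <= 4^-1 ^+ n by apply: fC.
  rewrite natrX exprS invfM mulrACA divff// mul1r mulrC [X in _ <= X]mulrDl mul1r.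
  rewrite [X in _ + X]mulrC lerD2r//.
  apply: le_trans (ler_wpM2r (ltW (p2 _)) h) _.
  by rewrite -exprMn -exprVn lerXn2r// ?nnegrE//; lra.
have aeC := ae_summable mD D0 Dint.
pose lr x := fine (limn_esup (fun n => (complex.Re (f_ n x))%:E)).
pose li x := fine (limn_esup (fun n => (complex.Im (f_ n x))%:E)).
pose f x : R[i] := (lr x +i* li x)%C.
have mf : cmeasurable f.
  by split; apply: measurable_limn_esup_fine => n; have [[]] := Lf n.
have f_cvg : {ae m, forall x, (complex.Re (f_ n x) @[n --> \oo] --> complex.Re (f x)) /\
                        (complex.Im (f_ n x) @[n --> \oo] --> complex.Im (f x))}.
  apply: filterS aeC => x cD; split => /=.
    have /cvg_ex[l ul] := cvg_of_summable_incr (ReD_^~ x) (D0^~ x) cD.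
    by rewrite /lr (cvg_limn_einf_sup (cvg_EFin_seq ul)).2.
  have /cvg_ex[l ul] := cvg_of_summable_incr (ImD_^~ x) (D0^~ x) cD.
  by rewrite /li (cvg_limn_einf_sup (cvg_EFin_seq ul)).2.
have key n : (\int[m]_x (cdot (f x - f_ n x) (f x - f_ n x))%:E <=
    ((4^-1) ^+ n)%:E)%E.
  apply: (@fatou_le _ _ _ _ (fun k x => cdot (f_ k x - f_ n x) (f_ k x - f_ n x))).
  - by move=> k; apply: measurable_cdot; case: (L2B (Lf k) (Lf n)).
  - by apply: measurable_cdot; apply: cmeasurableB => //; case: (Lf n).
  - by move=> *; exact: cdot_ge0.
  - by move=> *; exact: cdot_ge0.
  - apply: filterS f_cvg => x [cr ci].
    rewrite /cdot; under eq_fun do rewrite !cReB !cImB; rewrite !cReB !cImB.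
    by apply: cvgD; apply: cvgM; apply: cvgB => //; exact: cvg_cst.
  - near=> k; rewrite -nsqE; last exact: L2B.
    by rewrite lee_fin fC//; near: k; exists n.
have Lfn n : L2 m (fun x => f x - f_ n x).
  have mfn : cmeasurable (fun x => f x - f_ n x).
    by apply: cmeasurableB => //; case: (Lf n).
  split=> //; apply/integrableP; split; first exact/measurable_EFinP/measurable_cdot.
  under eq_integral do rewrite /= ger0_norm ?cdot_ge0//.
  exact: le_lt_trans (key n) (ltry _).
exists f => [|n]; last by rewrite -lee_fin nsqE.
by apply: eq_L2 (L2D (Lfn 0%N) (Lf 0%N)) => x; rewrite subrK.
Unshelve. all: by end_near. Qed.

(** The representing vector minimises J v = |v|^2 - 2 L v: by the parallelogram
    identity minimising sequences are Cauchy, and the first variation of J at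
    the minimiser vanishes, which is L f = <g, f>. *)
Lemma riesz_L2 (L : (T -> R[i]) -> R) :
  (forall f g, L2 m f -> L2 m g -> L (fun x => f x + g x) = L f + L g) ->
  (forall (a : R) f, L2 m f -> L (fun x => a%:C%C * f x) = a * L f) ->
  (forall f, L2 m f -> L f ^+ 2 <= nsq m f) ->
  exists2 g, L2 m g & forall f, L2 m f -> L f = dot m g f.
Proof.
move=> LD LZ Lb.
pose J v := nsq m v - 2 * L v.
pose E : set R := [set J v | v in L2 m].
have E0 : E !=set0 by exists (J (fun=> 0)), (fun=> 0) => //; exact: L2_0.
have Elb : has_lbound E.
  exists (-1) => _ [v Lv <-]; have := Lb _ Lv; rewrite /J.
  by have := sqr_ge0 (L v - 1); rewrite !expr2; nra.
have infE : has_inf E by [].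
have JI v : L2 m v -> inf E <= J v by move=> Lv; apply: ge_inf => //; exists v.
(* Testing J at midpoints gives |v_k - v_n|^2 <= 2 (e k + e n) <= 4 e n. *)
pose e n : R := 4^-1 ^+ n / 4.
have e0 n : 0 < e n by rewrite divr_gt0// exprn_gt0.
have /choice[v_ v_P] n : exists v, L2 m v /\ J v < inf E + e n.
  by have [_ [v Lv <-] Jv] := inf_adherent (e0 n) infE; exists v.
have Lv n : L2 m (v_ n) by have [] := v_P n.
have Jv n : J (v_ n) < inf E + e n by have [] := v_P n.
have e_dec n k : (n <= k)%N -> e k <= e n.
  move=> nk; rewrite ler_wpM2r// ?invr_ge0//; apply: ler_wiXn2l => //; lra.
have vC n k : (n <= k)%N -> nsq m (fun x => v_ k x - v_ n x) <= 4^-1 ^+ n.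
  move=> nk; have := JI _ (L2Z (2^-1) (L2D (Lv k) (Lv n))).
  rewrite /J nsqZ ?LZ ?LD//; try exact: L2D.
  have := Jv k; have := Jv n; have := e_dec _ _ nk; rewrite /J /e.
  rewrite nsqD// nsqB//; set q := 4^-1 ^+ n; lra.
have [g Lg gv] := L2_fast_cauchy Lv vC.
exists g => // f Lf.
(* J (v_n + t f) >= inf J for all t bounds the first variation at v_n. *)
have h1 n : (dot m (v_ n) f - L f) ^+ 2 <= e n * nsq m f.
  apply: quadratic_ge0 => t; have := JI _ (L2D (Lv n) (L2Z t Lf)).
  rewrite /J nsqD// ?nsqZ// ?LD ?LZ ?dotZr//; try exact: L2Z.
  have := Jv n; rewrite /J; lra.
(* 10 = 2 (4 + 1), by (x + y)^2 <= 2 (x^2 + y^2) with the bounds h4 and h1. *)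
have h2 n : (dot m g f - L f) ^+ 2 <= 10 * e n * nsq m f.
  have := dot_CS (L2B Lg (Lv n)) Lf; rewrite dotBl// => h3.
  have h4 : (dot m g f - dot m (v_ n) f) ^+ 2 <= 4 * e n * nsq m f.
    apply: le_trans h3 _; rewrite ler_wpM2r ?nsq_ge0// (le_trans (gv n))//.
    by rewrite /e mulrCA divff// mulr1.
  have := h1 n; have := sqr_ge0 (dot m g f - dot m (v_ n) f - (dot m (v_ n) f - L f)).
  move: h4; rewrite -!mulrA !expr2; set N := e n * nsq m f; nra.
apply/esym/eqP; rewrite -subr_eq0 -sqrf_eq0 eq_le sqr_ge0 andbT.
have : 10 * e n * nsq m f @[n --> \oo] --> (10 * (0 / 4) * nsq m f : R).
  apply: cvgMl; apply: cvgMr; apply: cvgMl.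
  by apply: cvg_expr; rewrite ger0_norm; lra.
rewrite mul0r mulr0 mul0r => cv0; rewrite -(cvg_lim _ cv0)//.
by apply: limr_ge; [exact: cvgP cv0|exact: nearW].
Qed.

End L2_complete.

(** * The Brezis-Lieb inequality *)

Section powR_facts.
Context {R : realType}.
Implicit Types (a b r x : R).

(** One of the two terms dominates: either b <= k a, and then a + b <= (1 + k) a,
    or a < b / k, and then a + b <= (1 + 1/k) b. *)
Lemma powRD_le a b r k : 0 <= a -> 0 <= b -> 0 < k -> 0 < r ->
  (a + b) `^ r <= (1 + k) `^ r * a `^ r + (1 + k^-1) `^ r * b `^ r.
Proof.
move=> a0 b0 k0 r0; have ki0 : 0 < k^-1 by rewrite invr_gt0.
have mon := ge0_ler_powR (ltW r0).
have [bka|kab] := leP b (k * a).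
- apply: (@le_trans _ _ ((1 + k) `^ r * a `^ r)).
    rewrite -powRM//; last by rewrite addr_ge0// ltW.
    by apply: mon; rewrite ?nnegrE ?mulr_ge0 ?addr_ge0 ?(ltW k0)// mulrDl mul1r lerD2l.
  by rewrite lerDl mulr_ge0// powR_ge0.
- apply: (@le_trans _ _ ((1 + k^-1) `^ r * b `^ r)).
    rewrite -powRM//; last by rewrite addr_ge0// ltW.
    apply: mon; rewrite ?nnegrE ?mulr_ge0 ?addr_ge0 ?(ltW ki0)//.
    by rewrite mulrDl mul1r addrC lerD2l mulrC ler_pdivlMr// mulrC ltW.
  by rewrite lerDr mulr_ge0// powR_ge0.
Qed.

Lemma cvg_powR_seq (u : nat -> R) (l r : R) : 0 < r -> (forall n, 0 <= u n) ->
  u n @[n --> \oo] --> l -> u n `^ r @[n --> \oo] --> l `^ r.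
Proof.
move=> r0 u0 ul.
have l0 : 0 <= l by rewrite -(cvg_lim _ ul)//; apply: limr_ge; [exact: cvgP ul|exact: nearW].
move: l0; rewrite le_eqVlt => /predU1P[l0|l0].
  rewrite -l0 powR0 ?gt_eqF//; apply/cvgr0Pnorm_lt => e e0.
  have e'0 : 0 < e `^ r^-1 by rewrite powR_gt0.
  near=> n; rewrite ger0_norm ?powR_ge0//.
  have -> : e = (e `^ r^-1) `^ r by rewrite -powRrM mulVf ?gt_eqF// powRr1// ltW.
  apply: gt0_ltr_powR; rewrite // ?nnegrE// ?ltW//.
  rewrite -(ger0_norm (u0 n)) -[u n]subr0 l0; near: n.
  by move/cvgrPdist_lt : ul => /(_ _ e'0); under eq_near do rewrite distrC.
have pE x : 0 < x -> x `^ r = expR (r * ln x).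
  by move=> x0; rewrite /powR gt_eqF.
rewrite pE//.
have : expR (r * ln (u n)) @[n --> \oo] --> expR (r * ln l).
  apply: continuous_cvg; first exact: continuous_expR.
  apply: cvgMr; apply: continuous_cvg => //; exact: continuous_ln.
apply: cvg_trans; apply: near_eq_cvg; near=> n; rewrite pE//.
near: n; exact: (cvgr_gt _ ul).
Unshelve. all: by end_near. Qed.

End powR_facts.

Section ge0_integral_EFin.
Context d (T : measurableType d) {R : realType}.
Variable m : {measure set T -> \bar R}.
Implicit Types f g : T -> R.
Local Open Scope ereal_scope.

Lemma le_integral_EFin f g : measurable_fun setT f -> measurable_fun setT g ->
  (forall x, 0 <= f x)%R -> (forall x, f x <= g x)%R ->
  \int[m]_x (f x)%:E <= \int[m]_x (g x)%:E.
Proof.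
move=> mf mg f0 fg; apply: ge0_le_integral => //.
- by move=> x _; rewrite lee_fin.
- exact/measurable_EFinP.
- exact/measurable_EFinP.
- by move=> x _; rewrite lee_fin.
Qed.

Lemma integralD_EFin_ge0 f g : measurable_fun setT f -> measurable_fun setT g ->
  (forall x, 0 <= f x)%R -> (forall x, 0 <= g x)%R ->
  \int[m]_x (f x + g x)%:E = \int[m]_x (f x)%:E + \int[m]_x (g x)%:E.
Proof.
move=> mf mg f0 g0; under eq_integral do rewrite EFinD.
have h (h : T -> R) : (forall x, 0 <= h x)%R -> forall x, setT x -> 0 <= (h x)%:E.
  by move=> h0 x _; rewrite lee_fin.
by rewrite ge0_integralD//; [exact: h|exact/measurable_EFinP|exact: h|exact/measurable_EFinP].
Qed.

Lemma integralZl_EFin_ge0 (k : R) f : measurable_fun setT f ->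
  (0 <= k)%R -> (forall x, 0 <= f x)%R ->
  \int[m]_x (k * f x)%:E = k%:E * \int[m]_x (f x)%:E.
Proof.
move=> mf k0 f0; under eq_integral do rewrite EFinM.
rewrite ge0_integralZl//; first exact/measurable_EFinP.
by move=> x _; rewrite lee_fin.
Qed.

End ge0_integral_EFin.

Section brezis_lieb.
Context d (T : measurableType d) {R : realType}.
Variable m : {measure set T -> \bar R}.

Lemma measurable_powR_comp (f : T -> R) (r : R) : measurable_fun setT f ->
  measurable_fun setT (fun x => f x `^ r).
Proof. by move=> mf; exact: (measurableT_comp (measurable_powR r) mf). Qed.

(** Upper half of the Brezis-Lieb lemma, for u the modulus of a sequence, v that
    of its pointwise limit and a that of the difference.  The excess of u^r over
    (1 + e) a^r + v^r tends to 0 pointwise and is dominated by a multiple of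
    v^r, so its positive part tends to 0 in mean.  The factor 1 + e absorbs the
    cross terms of (a + v)^r, which v^r alone does not dominate. *)
Lemma brezis_lieb_le (u a : nat -> T -> R) (v : T -> R) (r e : R) :
  0 < r -> 0 < e ->
  (forall n, measurable_fun setT (u n)) -> (forall n, measurable_fun setT (a n)) ->
  measurable_fun setT v ->
  (forall n x, 0 <= u n x) -> (forall n x, 0 <= a n x) -> (forall x, 0 <= v x) ->
  (forall n x, u n x <= a n x + v x) -> (forall n x, v x <= u n x + a n x) ->
  (forall x, a n x @[n --> \oo] --> 0) ->
  (\int[m]_x (v x `^ r)%:E < +oo)%E ->
  exists2 w : nat -> R, w n @[n --> \oo] --> 0 &
  forall n, (\int[m]_x (u n x `^ r)%:E <=
    (1 + e)%:E * \int[m]_x (a n x `^ r)%:E + \int[m]_x (v x `^ r)%:E + (w n)%:E)%E.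
Proof.
move=> r0 e0 mu ma mv u0 a0 v0 uav vua a_0 vfin.
(* Chosen so that (1 + k)^r = 1 + e. *)
pose k := (1 + e) `^ r^-1 - 1.
have k0 : 0 < k.
  have h : 1 `^ r^-1 < (1 + e) `^ r^-1.
    by apply: gt0_ltr_powR; rewrite ?invr_gt0 ?nnegrE//; lra.
  by rewrite powR1 in h; rewrite subr_gt0.
have kE : (1 + k) `^ r = 1 + e.
  by rewrite /k addrC subrK -powRrM mulVf ?gt_eqF// powRr1//; lra.
pose C := (1 + k^-1) `^ r.
(* The excess, truncated at 0 so that only an upper bound for u is needed. *)
pose W n x : R := Num.max 0 (u n x `^ r - (1 + e) * a n x `^ r - v x `^ r).
have mW n : measurable_fun setT (W n).
  apply: measurable_maxr => //; apply: measurable_funB; last exact: measurable_powR_comp.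
  apply: measurable_funB; first exact: measurable_powR_comp.
  by apply: measurable_funM => //; exact: measurable_powR_comp.
have W0 n x : 0 <= W n x by rewrite le_max lexx.
have WC n x : W n x <= C * v x `^ r.
  rewrite ge_max mulr_ge0 ?powR_ge0//=.
  have := powRD_le (a0 n x) (v0 x) k0 r0; rewrite kE -/C => h.
  have : u n x `^ r <= (a n x + v x) `^ r.
    by apply: ge0_ler_powR; rewrite ?nnegrE ?addr_ge0// ltW.
  have := powR_ge0 (v x) r; lra.
have u_v x : u n x @[n --> \oo] --> v x.
  apply/cvgrPdist_lt => q q0; have := a_0 x => /cvgr0Pnorm_lt /(_ _ q0) aq.
  near=> n; have : a n x < q by rewrite -(ger0_norm (a0 n x)); near: n.
  have := uav n x; have := vua n x; rewrite ltr_norml => h1 h2 h3.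
  by apply/andP; split; lra.
have Wcvg x : W n x @[n --> \oo] --> 0.
  have h : u n x `^ r - (1 + e) * a n x `^ r - v x `^ r @[n --> \oo] -->
      v x `^ r - (1 + e) * 0 `^ r - v x `^ r.
    apply: cvgB; last exact: cvg_cst.
    by apply: cvgB; [|apply: cvgMr]; apply: cvg_powR_seq.
  rewrite powR0 ?gt_eqF// mulr0 subr0 subrr in h.
  apply/cvgr0Pnorm_lt => q q0; near=> n.
  rewrite ger0_norm// gt_max q0/=; apply: le_lt_trans (ler_norm _) _.
  by near: n; move: q q0; exact/cvgr0Pnorm_lt.
have mvr : measurable_fun setT (fun x => (v x `^ r)%:E).
  exact/measurable_EFinP/measurable_powR_comp.
have iv : m.-integrable setT (fun x => (C * v x `^ r)%:E).
  under eq_fun do rewrite EFinM; apply: integrableZl => //.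
  by apply/integrableP; split=> //; under eq_integral do rewrite /= ger0_norm ?powR_ge0//.
have Wle x n : setT x -> (`|(W n x)%:E| <= (C * v x `^ r)%:E)%E.
  by rewrite /= lee_fin ger0_norm.
have [_ _] := @dominated_convergence _ _ _ m setT measurableT
  (fun n x => (W n x)%:E) (fun=> 0%E) (fun x => (C * v x `^ r)%:E)
  (fun n => (measurable_EFinP _ _).2 (mW n)) (measurable_cst _)
  (nearW _ (fun x _ => cvg_EFin_seq (Wcvg x))) iv
  (nearW _ Wle).
rewrite integral0 => Wint.
have iW n : m.-integrable setT (fun x => (W n x)%:E).
  apply: le_integrable iv => //; first exact/measurable_EFinP.
  by move=> x _ /=; rewrite lee_fin !ger0_norm ?mulr_ge0 ?powR_ge0.
exists (fun n => \int[m]_x W n x); first exact: fine_cvg Wint.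
move=> n; rewrite /Rintegral fineK; last exact: (integrable_fin_num measurableT).
have e1 : 0 <= 1 + e by lra.
have mp (f : T -> R) (mf : measurable_fun setT f) := measurable_powR_comp r mf.
have m1 : measurable_fun setT (fun x => (1 + e) * a n x `^ r).
  by apply: measurable_funM => //; exact: mp.
have m2 : measurable_fun setT (fun x => (1 + e) * a n x `^ r + v x `^ r).
  by apply: measurable_funD => //; exact: mp.
have p0 (f : T -> R) x : 0 <= f x `^ r by exact: powR_ge0.
have p1 x : 0 <= (1 + e) * a n x `^ r by rewrite mulr_ge0.
rewrite -integralZl_EFin_ge0 -?integralD_EFin_ge0//.
- apply: le_integral_EFin => //; [exact: mp|exact: measurable_funD|].
  move=> x; have : u n x `^ r - (1 + e) * a n x `^ r - v x `^ r <= W n x.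
    by rewrite le_max lexx orbT.
  lra.
- by move=> x; rewrite addr_ge0.
- exact: mp.
- exact: mp.
Unshelve. all: by end_near. Qed.

End brezis_lieb.

(** * Lebesgue measure on R^d: translations and neighbourhoods *)

Section translation.
Context {R : realType}.

Lemma lebesgue_measure_translate (t : R) (A : set R) : measurable A ->
  pushforward (@lebesgue_measure R)
    ((fun x => x + t) : measurableTypeR R -> measurableTypeR R) A =
  lebesgue_measure A.
Proof.
move=> mA; apply/esym/lebesgue_measure_unique => //=.
  exact: measurable_funD.
move=> mt _ [[a b]] _ <-; rewrite /pushforward.
rewrite (_ : _ @^-1` _ = `](a - t), (b - t)]%classic); last first.
  by apply/seteqP; split => x /=; rewrite !in_itv/= ltrBlDr lerBrDr.
rewrite [LHS](lebesgue_measure_itv `]a, b])/= [RHS](lebesgue_measure_itv `](a - t), (b - t)])/=.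
by rewrite !lte_fin ltrD2r; case: ifP => // _; rewrite -!EFinD opprB addrA addrNK.
Qed.

Lemma measurable_translate n (c : 'rV[R]_n) :
  measurable_fun setT (fun v : 'rV[R]_n => v + c).
Proof.
apply: measurable_fun_rVP => j; under eq_fun do rewrite mxE.
by apply: measurable_funD => //; exact: measurable_fun_coord.
Qed.

(** By induction on the dimension: a translation of R * R^n is a product of
    translations, and the product measure is determined on rectangles. *)
Lemma lebesgue_rV_translate n (c : 'rV[R]_n) (A : set 'rV[R]_n) : measurable A ->
  lebesgue_rV R n ((fun v => v + c) @^-1` A) = lebesgue_rV R n A.
Proof.
elim: n c A => [|n IH] c A mA.
  have E (v : 'rV[R]_0) : v + c = v by apply/rowP => -[].
  suff -> : (fun v => v + c) @^-1` A = A by [].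
  by apply/seteqP; split => v /=; rewrite E.
rewrite /= /lebesgue_step /pushforward.
pose cons (xv : R * 'rV[R]_n) : 'rV[R]_n.+1 := row_mx xv.1%:M xv.2.
pose t := c 0 0; pose c' : 'rV[R]_n := \row_j c 0 (lift ord0 j).
have mcons : measurable_fun setT cons by exact: measurable_fun_row_mx.
pose tau (xv : measurableTypeR R * 'rV[R]_n) : measurableTypeR R * 'rV[R]_n :=
  (xv.1 + t, xv.2 + c').
have mtau : measurable_fun setT tau.
  apply/measurable_fun_pairP; split => /=.
    by apply: measurable_funD.
  exact: (measurableT_comp (measurable_translate c') measurable_snd).
have consD xv : cons xv + c = cons (tau xv).
  apply/rowP => j; rewrite mxE /cons /tau /=.
  case: (unliftP ord0 j) => [k|] ->.
    have E (x : R) (v : 'rV[R]_n) : (row_mx x%:M v : 'rV_n.+1) 0 (lift ord0 k) = v 0 k.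
      have := row_mxEr (x%:M : 'M[R]_1) v 0 k => <-.
      by congr (row_mx _ _ _ _); exact: val_inj.
    by rewrite !E !mxE.
  have E (x : R) (v : 'rV[R]_n) : (row_mx x%:M v : 'rV_n.+1) 0 ord0 = x.
    have := row_mxEl (x%:M : 'M[R]_1) v 0 0; rewrite [RHS]mxE eqxx mulr1n => {2}<-.
    by congr (row_mx _ _ _ _); exact: val_inj.
  by rewrite !E.
have mB : measurable (cons @^-1` A) by rewrite -[X in measurable X]setTI; exact: mcons.
rewrite (_ : _ @^-1` _ = tau @^-1` (cons @^-1` A)); last first.
  by apply/seteqP; split => xv /=; rewrite -[row_mx _ _]/(cons xv) consD.
apply/esym.
have := @product_measure_unique _ _ _ _ R (@lebesgue_measure R) (lebesgue_rV R n)
  (pushforward (@lebesgue_measure R \x lebesgue_rV R n)%E tau).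
apply => //.
move=> X Y mX mY.
rewrite -[LHS]/((@lebesgue_measure R \x lebesgue_rV R n)%E
  (((fun x => x + t) @^-1` X) `*` ((fun v => v + c') @^-1` Y))).
rewrite product_measure1E.
- rewrite IH//; congr (_ * _)%E.
  exact: (lebesgue_measure_translate t mX).
- rewrite -[X in measurable X]setTI.
  have : measurable_fun setT ((fun x => x + t) : measurableTypeR R -> measurableTypeR R).
    exact: measurable_funD.
  exact.
- by rewrite -[X in measurable X]setTI; exact: measurable_translate.
Qed.

Lemma integral_translate n (c : 'rV[R]_n) (f : 'rV[R]_n -> \bar R) :
  measurable_fun setT f -> (forall x, (0 <= f x)%E) ->
  (\int[lebesgue_rV R n]_x f (x + c)%R = \int[lebesgue_rV R n]_x f x)%E.
Proof.
move=> mf f0; have mt := measurable_translate c.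
have := @ge0_integral_pushforward _ _ _ _ R (fun v : 'rV[R]_n => v + c) mt
  (lebesgue_rV R n) setT f measurableT mf (fun y _ => f0 y).
rewrite preimage_setT => <-; apply: eq_measure_integral => A mA _.
exact: lebesgue_rV_translate.
Qed.

Lemma rV_nbhs_box n (U : set 'rV[R]_n) (x : 'rV[R]_n) : nbhs x U ->
  exists2 e : R, 0 < e & forall y : 'rV[R]_n, (forall j, `|x 0 j - y 0 j| < e) -> U y.
Proof.
move=> /nbhs_ballP[e /= e0 eU]; exists e => // y xy; apply: eU.
by split => // i j; rewrite ord1 /ball /=; exact: xy.
Qed.

Lemma lebesgue_rV_nbhs_gt0 n (U : set 'rV[R]_n) (x : 'rV[R]_n) :
  measurable U -> nbhs x U -> (0 < lebesgue_rV R n U)%E.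
Proof.
move=> mU /rV_nbhs_box[e e0 xU].
pose a : 'rV[R]_n := \row_j (x 0 j - e / 2); pose b : 'rV[R]_n := \row_j (x 0 j + e / 2).
apply: (@lt_le_trans _ _ (lebesgue_rV R n [set v | forall j, a 0 j <= v 0 j <= b 0 j])).
  rewrite lebesgue_rV_box; last by move=> j; rewrite !mxE; lra.
  by rewrite lte_fin; apply: prodr_gt0 => j _; rewrite !mxE; lra.
apply: le_measure; rewrite ?inE//; first exact: measurable_rV_box.
move=> v /= vab; apply: xU => j; have := vab j; rewrite !mxE ltr_norml => /andP[h1 h2].
by apply/andP; split; lra.
Qed.

(** Nonempty open sets have positive Lebesgue measure, so an inequality between
    continuous functions that holds almost everywhere holds at every point. *)
Lemma continuous_le0_of_ae n (f : 'rV[R]_n -> R) (x : 'rV[R]_n) :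
  measurable_fun setT f -> {for x, continuous f} ->
  {ae lebesgue_rV R n, forall y, f y <= 0} -> f x <= 0.
Proof.
move=> mf cf [N [mN N0 fN]]; rewrite leNgt; apply/negP => fx.
have mU : measurable (f @^-1` `]0, +oo[).
  by rewrite -[X in measurable X]setTI; exact: mf.
have nU : nbhs x (f @^-1` `]0, +oo[).
  apply: cf; apply: open_nbhs_nbhs; split; first exact: interval_open.
  by rewrite /= in_itv/= fx.
have := lebesgue_rV_nbhs_gt0 mU nU; rewrite ltNge => /negP; apply.
rewrite -N0; apply: le_measure; rewrite ?inE//.
by move=> y /=; rewrite in_itv/= andbT => fy; apply: fN => /=; rewrite leNgt fy.
Qed.

End translation.

(** * Compactly supported Radon measures *)

Section radon_support.
Context {R : realType} {n : nat}.
Variable mu : {measure set 'rV[R]_n -> \bar R}.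
Hypothesis mu_radon : radon mu.
Hypothesis mu_compact : compact (msupport mu).

Lemma rV_hausdorff : hausdorff_space 'rV[R]_n.
Proof. exact: norm_hausdorff. Qed.

Lemma rV_compact_measurable (K : set 'rV[R]_n) : compact K -> measurable K.
Proof.
move=> cK; have cl : closed K by apply: compact_closed => //; exact: rV_hausdorff.
have /measurableC : measurable (~` K).
  by apply: rV_open_measurable; rewrite -closedC setCK.
by rewrite setCK.
Qed.

(** By inner regularity it is enough to consider a compact subset of the
    complement, which is covered by finitely many null open sets. *)
Lemma msupport_null : mu (~` msupport mu) = 0%E.
Proof.
have [_ inner] := mu_radon.
rewrite inner; last exact: measurableC (rV_compact_measurable mu_compact).
have -> : [set mu K | K in [set K | compact K /\ K `<=` ~` msupport mu]] = [set 0%E].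
  apply/seteqP; split => [_ [K [cK KS] <-]|_ ->]; last first.
    by exists set0; [split; [exact: compact0|exact: sub0set]|exact: measure0].
  have /choice[U UP] x : exists U : set 'rV[R]_n, open U /\ (K x -> U x /\ mu U = 0%E).
    have [Kx|nKx] := pselect (K x); last by exists set0; split => //; exact: open0.
    have := KS _ Kx => /existsNP[U] /not_implyP[oU] /not_implyP[Ux] /negP.
    rewrite -leNgt measure_le0 => /eqP U0.
    by exists U; split.
  have := cK; rewrite compact_cover => /(_ _ K U).
  case=> [x _|x Kx|D DK KD]; [by have [] := UP x|by exists x => //; have [_ []] := UP x|].
  have mK := rV_compact_measurable cK.
  apply/(negligibleP mu mK); apply: negligibleS KD _.
  rewrite /cover bigcup_fset big_seq_cond.
  elim/big_ind : _ => //; [exact: negligible_set0|exact: negligibleU|].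
  move=> i /andP[iD _]; have [oU] := UP i; have := DK _ iD; rewrite inE => Ki /(_ Ki)[_ U0].
  exact/(negligibleP mu (rV_open_measurable oU)).
by rewrite ereal_sup1.
Qed.

Lemma radon_finite : (mu setT < +oo)%E.
Proof.
have [fin _] := mu_radon; have mS := rV_compact_measurable mu_compact.
have mC : measurable (~` msupport mu) by exact: measurableC.
have -> : mu setT = (mu (msupport mu) + mu (~` msupport mu))%E.
  by rewrite -[in LHS](setUv (msupport mu)); exact: (measureU mu mS mC (setICr _)).
by rewrite msupport_null adde0; exact: fin.
Qed.

Lemma coord_le_norm (x : 'rV[R]_n) j : `|x 0 j| <= `|x|.
Proof.
apply/ler_addgt0Pr => e e0.
have : ball (0 : 'rV[R]_n) (`|x| + e) x.
  by rewrite mx_norm_ball /ball_ /= sub0r normrN ltrDl.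
by move=> [_ /(_ 0 j)]; rewrite /ball /= mxE sub0r normrN => /ltW.
Qed.

(** The bound holds almost everywhere only: the support has full measure. *)
Lemma msupport_bounded : exists2 M : R, 0 < M &
  {ae mu, forall x : 'rV[R]_n, forall j : 'I_n, `|x 0 j| <= M}.
Proof.
have /compact_bounded/pinfty_ex_gt0[M M0 KM] := mu_compact.
exists M => //; exists (~` msupport mu); split.
- exact: measurableC (rV_compact_measurable mu_compact).
- exact: msupport_null.
- move=> x /=; apply: contra_not => Sx j.
  exact: le_trans (coord_le_norm x j) (KM _ Sx).
Qed.

End radon_support.

(** * Density of continuous functions in L^2 *)

Section continuous_dense.
Context {R : realType} {n : nat}.
Variable mu : {measure set 'rV[R]_n -> \bar R}.
Hypothesis mu_radon : radon mu.
Hypothesis mfin : (mu setT < +oo)%E.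
Implicit Types h k : 'rV[R]_n -> R[i].

Definition continuous_approx h := L2 mu h /\ forall e : R, 0 < e ->
  exists k, [/\ L2 mu k, continuous (fun x => complex.Re (k x)),
    continuous (fun x => complex.Im (k x)) & nsq mu (fun x => h x - k x) <= e].

Lemma continuous_approx_closed h : L2 mu h ->
  (forall e : R, 0 < e -> exists2 h', continuous_approx h' &
     nsq mu (fun x => h x - h' x) <= e) -> continuous_approx h.
Proof.
move=> Lh H; split=> // e e0; have e4 : 0 < e / 4 by lra.
have [h' [Lh' h'P] hh'] := H _ e4; have [k [Lk kr ki h'k]] := h'P _ e4.
exists k; split => //.
have := nsqD_le (L2B Lh Lh') (L2B Lh' Lk).
rewrite (nsq_eq mu (g := fun x => h x - k x)); last by move=> x; rewrite addrA subrK.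
lra.
Qed.

Lemma continuous_lin (f g : 'rV[R]_n -> R) (a b : R) :
  continuous f -> continuous g -> continuous (fun x => a * f x + b * g x).
Proof.
move=> cf cg x.
apply: (@continuousD _ _ _ (fun y => a * f y) (fun y => b * g y) x);
  apply: continuousM; by [exact: cst_continuous|exact: cf|exact: cg].
Qed.

Lemma continuous_approxD h1 h2 : continuous_approx h1 -> continuous_approx h2 ->
  continuous_approx (fun x => h1 x + h2 x).
Proof.
move=> [L1 a1] [L2 a2]; split; first exact: L2D.
move=> e e0; have e4 : 0 < e / 4 by lra.
have [k1 [Lk1 kr1 ki1 hk1]] := a1 _ e4; have [k2 [Lk2 kr2 ki2 hk2]] := a2 _ e4.
exists (fun x => k1 x + k2 x); split; first exact: L2D.
- rewrite (_ : (fun x => _) = (fun x => 1 * complex.Re (k1 x) + 1 * complex.Re (k2 x))).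
    exact: continuous_lin.
  by apply/funext => x; rewrite cReD !mul1r.
- rewrite (_ : (fun x => _) = (fun x => 1 * complex.Im (k1 x) + 1 * complex.Im (k2 x))).
    exact: continuous_lin.
  by apply/funext => x; rewrite cImD !mul1r.
- have := nsqD_le (L2B L1 Lk1) (L2B L2 Lk2).
  rewrite (nsq_eq mu (g := fun x => h1 x + h2 x - (k1 x + k2 x))); last first.
    by move=> x; rewrite opprD addrACA.
  lra.
Qed.

Lemma L2_cM_nsq (a : R[i]) h : L2 mu h ->
  L2 mu (fun x => a * h x) /\ nsq mu (fun x => a * h x) = cdot a a * nsq mu h.
Proof.
move=> [mh ih]; split.
  split; first exact/cmeasurableM/mh/cmeasurable_cst.
  by under eq_fun do rewrite cdotM EFinM; exact: integrableZl.
rewrite /nsq /dot -RintegralZl//.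
by apply: eq_Rintegral => x _; rewrite cdotM.
Qed.

Lemma continuous_approxM (a : R[i]) h : continuous_approx h ->
  continuous_approx (fun x => a * h x).
Proof.
move=> [Lh ah]; split; first by have [] := L2_cM_nsq a Lh.
move=> e e0; have a1 : 0 < cdot a a + 1 by rewrite ltr_wpDl// cdot_ge0.
have [k [Lk kr ki hk]] := ah _ (divr_gt0 e0 a1).
exists (fun x => a * k x); split; first by have [] := L2_cM_nsq a Lk.
- rewrite (_ : (fun x => _) = (fun x => complex.Re a * complex.Re (k x) +
      (- complex.Im a) * complex.Im (k x))); first exact: continuous_lin.
  by apply/funext => x; rewrite cReM mulNr.
- rewrite (_ : (fun x => _) = (fun x => complex.Re a * complex.Im (k x) +
      complex.Im a * complex.Re (k x))); first exact: continuous_lin.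
  by apply/funext => x; rewrite cImM.
- rewrite (nsq_eq mu (g := fun x => a * (h x - k x))); last by move=> x; rewrite mulrBr.
  have [_ ->] := L2_cM_nsq a (L2B Lh Lk).
  apply: le_trans (ler_wpM2l (cdot_ge0 _) hk) _.
  rewrite mulrCA -[X in _ <= X]mulr1 ler_wpM2l// ?(ltW e0)//.
  by rewrite ler_pdivrMr// mul1r lerDl.
Qed.

Lemma L2_bounded h (M : R) : cmeasurable h -> (forall x, cdot (h x) (h x) <= M) -> L2 mu h.
Proof.
move=> mh hM; split=> //; apply/integrableP; split.
  exact/measurable_EFinP/measurable_cdot.
apply: (@le_lt_trans _ _ (\int[mu]_x (M%:E))%E).
  apply: ge0_le_integral => //.
  - by apply: measurableT_comp => //; exact/measurable_EFinP/measurable_cdot.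
  - by move=> x _; rewrite /= lee_fin ger0_norm ?cdot_ge0.
have M0 : 0 <= M by apply: le_trans (hM 0); exact: cdot_ge0.
by rewrite integral_cst// lte_mul_pinfty// lee_fin.
Qed.

Lemma cmeasurable_real (f : 'rV[R]_n -> R) : measurable_fun setT f ->
  cmeasurable (fun x => (f x)%:C%C).
Proof. by move=> mf; split. Qed.

Lemma cdot_real (a b : R) : cdot a%:C%C b%:C%C = a * b.
Proof. by rewrite /cdot/= mulr0 addr0. Qed.

Lemma nsq_real_le (f : 'rV[R]_n -> R) (B : R) : L2 mu (fun x => (f x)%:C%C) ->
  (\int[mu]_x (f x ^+ 2)%:E <= B%:E)%E -> nsq mu (fun x => (f x)%:C%C) <= B.
Proof.
move=> Lf; rewrite -lee_fin nsqE//.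
by under [in X in _ -> X]eq_integral do rewrite cdot_real -expr2.
Qed.

Lemma inner_compact (B : set 'rV[R]_n) (e : R) : measurable B -> 0 < e ->
  exists2 K, compact K /\ K `<=` B & (mu (B `\` K) < e%:E)%E.
Proof.
move=> mB e0; have [_ inner] := mu_radon.
have Bfin : (mu B < +oo)%E by rewrite (le_lt_trans _ mfin)// le_measure ?inE.
have Bnum : mu B \is a fin_num by rewrite ge0_fin_numE.
have := inner B mB => supE.
have snum : ereal_sup [set mu K | K in [set K | compact K /\ K `<=` B]] \is a fin_num.
  by rewrite -supE.
have [_ [K [cK KB] <-]] := ub_ereal_sup_adherent e0 snum.
rewrite -supE => h; exists K => //.
rewrite measureD//; last exact: rV_compact_measurable.
have -> : B `&` K = K by apply: setIidr.
have Knum : mu K \is a fin_num.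
  by rewrite ge0_fin_numE// (le_lt_trans _ Bfin)// le_measure ?inE//; exact: rV_compact_measurable.
by rewrite lteBlDr// addeC -lteBlDr.
Qed.

(** Compact sets K inside A and L inside its complement miss little mass; a
    Urysohn function equal to 1 on K and 0 on L differs from the indicator only
    on the two missing pieces, and there by at most 1. *)
Lemma continuous_approx_indic (A : set 'rV[R]_n) : measurable A ->
  continuous_approx (fun x => (\1_A x)%:C%C).
Proof.
move=> mA.
have LA : L2 mu (fun x => (\1_A x : R)%:C%C).
  apply: (@L2_bounded _ 1); first exact: cmeasurable_real.
  by move=> x; rewrite cdot_real indicE; case: (x \in A); rewrite ?mulr1 ?mulr0.
split => // e e0; have e2 : 0 < e / 2 by lra.
have [K [cK KA] muK] := inner_compact mA e2.
have [L [cL LA'] muL] := inner_compact (measurableC mA) e2.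
have := @normal_separatorP R 'rV[R]_n => -[/(_ pseudometric_normal) + _].
move=> /(_ L K) sep.
have {sep} /(@uniform_separatorP _ R)[f [cf f01 fL fK]] : uniform_separator L K.
  apply: sep; [exact: compact_closed rV_hausdorff cL|exact: compact_closed rV_hausdorff cK|].
  by apply/seteqP; split => // x [/LA' nA /KA].
have f01' x : 0 <= f x <= 1 by have /= := f01 (f x); rewrite in_itv/=; apply; exists x.
have mf : measurable_fun setT f by exact: measurable_fun_rV_continuous.
have Lf : L2 mu (fun x => (f x)%:C%C).
  apply: (@L2_bounded _ 1); first exact: cmeasurable_real.
  by move=> x; rewrite cdot_real; have := f01' x; nra.
exists (fun x => (f x)%:C%C); split => //; first exact: cst_continuous.
have := L2B LA Lf.
have -> : (fun x => (\1_A x)%:C%C - (f x)%:C%C) = (fun x => (\1_A x - f x)%:C%C).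
  by apply/funext => x; rewrite rmorphB.
move=> Ld; apply: nsq_real_le => //.
have mK := rV_compact_measurable cK; have mL := rV_compact_measurable cL.
have mAK : measurable (A `\` K) by exact: measurableD.
have mAL : measurable (~` A `\` L) by apply: measurableD => //; exact: measurableC.
apply: (@le_trans _ _ (\int[mu]_x (\1_(A `\` K) x + \1_(~` A `\` L) x)%:E)%E).
  apply: le_integral_EFin => //.
  - by apply: measurable_funX; apply: measurable_funB.
  - by apply: measurable_funD.
  - by move=> x; exact: sqr_ge0.
  - move=> x; rewrite !indicE !in_setD in_setC.
    have [xA|xA] := boolP (x \in A) => /=.
      have [xK|xK] := boolP (x \in K) => /=.
        have -> : f x = 1 by apply: fK; exists x => //; exact/set_mem.
        by rewrite subrr expr0n/= addr0.
      by rewrite addr0; have := f01' x; rewrite expr2; nra.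
    have [xL|xL] := boolP (x \in L) => /=.
      have -> : f x = 0 by apply: fL; exists x => //; exact/set_mem.
      by rewrite subrr expr0n/= addr0.
    by rewrite add0r; have := f01' x; rewrite expr2; nra.
rewrite integralD_EFin_ge0//.
by rewrite !integral_indic// !setIT [e]splitr EFinD leeD// ltW.
Qed.

Import HBSimple HBNNSimple.

Lemma continuous_approx_sfun (g : {nnsfun 'rV[R]_n >-> R}) :
  continuous_approx (fun x => (g x)%:C%C).
Proof.
have -> : (fun x => (g x)%:C%C) = (fun x => \sum_(y <- finmap.enum_fset (fset_set (range g)))
    y%:C%C * (\1_(g @^-1` [set y]) x)%:C%C).
  apply/funext => x; rewrite {1}fimfunE fsbig_finite//= rmorph_sum/=.
  by apply: eq_bigr => i _; rewrite rmorphM.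
have E (s : seq R) (F : R -> 'rV[R]_n -> R[i]) : (forall i, continuous_approx (F i)) ->
    continuous_approx (fun x => \sum_(y <- s) F y x).
  move=> aF; elim: s => [|y s IH].
    under eq_fun do rewrite big_nil.
    have := continuous_approxM 0 (continuous_approx_indic measurableT).
    by under eq_fun do rewrite mul0r.
  by under eq_fun do rewrite big_cons; exact: continuous_approxD.
apply: E => i; apply: continuous_approxM; apply: continuous_approx_indic.
exact: measurable_sfunP.
Qed.

Lemma continuous_approx_ge0 (f : 'rV[R]_n -> R) : L2 mu (fun x => (f x)%:C%C) ->
  (forall x, 0 <= f x) -> continuous_approx (fun x => (f x)%:C%C).
Proof.
move=> Lf f0; apply: continuous_approx_closed => // e e0.
have mf : measurable_fun setT f by have [[]] := Lf.
have mEf : measurable_fun setT (EFin \o f) by exact/measurable_EFinP.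
pose g := nnsfun_approx measurableT mEf.
have gf x : (g k x)%:E @[k --> \oo] --> (f x)%:E.
  by apply: (cvg_nnsfun_approx measurableT mEf) => // y _; rewrite lee_fin.
have gf' x : g k x @[k --> \oo] --> f x by have /fine_cvg := gf x.
have gle (k : nat) x : g k x <= f x.
  rewrite -(cvg_lim _ (gf' x))//; apply: nondecreasing_cvgn_le; last exact: cvgP (gf' x).
  by move=> a b ab; have /lefP := nd_nnsfun_approx measurableT mEf ab; exact.
have f2 : mu.-integrable setT (fun x => (f x ^+ 2)%:E).
  by have [_] := Lf; under eq_fun do rewrite cdot_real -expr2.
have md (k : nat) : measurable_fun setT (fun x => ((f x - g k x) ^+ 2)%:E).
  by apply/measurable_EFinP/measurable_funX/measurable_funB.
have cv x : setT x -> ((f x - g k x) ^+ 2)%:E @[k --> \oo] --> 0%E.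
  move=> _; apply: cvg_EFin_seq; have -> : 0 = (f x - f x) ^+ 2 by rewrite subrr expr0n.
  by rewrite expr2; under eq_fun do rewrite expr2; apply: cvgM; apply: cvgB => //; exact: cvg_cst.
have dom x (k : nat) : setT x -> (`|((f x - g k x) ^+ 2)%:E| <= (f x ^+ 2)%:E)%E.
  move=> _; rewrite /= lee_fin ger0_norm ?sqr_ge0//.
  have := gle k x; have : 0 <= g k x by [].
  by move=> h1 h2; rewrite lerXn2r// ?nnegrE ?subr_ge0// lerBlDr lerDl.
have [_ _] := @dominated_convergence _ _ _ mu setT measurableT
  (fun (k : nat) x => ((f x - g k x) ^+ 2)%:E) (fun=> 0%E) (fun x => (f x ^+ 2)%:E)
  md (measurable_cst _) (nearW _ cv) f2 (nearW _ dom).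
rewrite integral0 => /fine_cvgP[_ /cvgr0Pnorm_lt /(_ _ e0)[N _ /(_ N (leqnn N)) /= hN]].
exists (fun x => (g N x)%:C%C); first exact: continuous_approx_sfun.
have [Lg _] := continuous_approx_sfun (g N).
rewrite (nsq_eq mu (g := fun x => (f x - g N x)%:C%C)); last by move=> x; rewrite rmorphB.
move: hN; rewrite ger0_norm; last first.
  by apply: fine_ge0; apply: integral_ge0 => x _; rewrite lee_fin sqr_ge0.
move=> /ltW; apply: le_trans; rewrite /nsq /dot le_eqVlt; apply/orP; left; apply/eqP.
by apply: eq_Rintegral => x _; rewrite cdot_real expr2.
Qed.

(** Indicators, then simple functions, then nonnegative functions by dominated
    convergence, then the positive and negative parts of real and imaginary
    part. *)
Theorem continuous_dense_L2 h : L2 mu h -> continuous_approx h.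
Proof.
move=> Lh; have [[mr mi] ih] := Lh.
have key (f : 'rV[R]_n -> R) : measurable_fun setT f ->
    (forall x, f x ^+ 2 <= cdot (h x) (h x)) -> continuous_approx (fun x => (f x)%:C%C).
  move=> mf fh.
  have Lp (g : 'rV[R]_n -> R) : measurable_fun setT g -> (forall x, 0 <= g x) ->
      (forall x, g x <= `|f x|) -> continuous_approx (fun x => (g x)%:C%C).
    move=> mg g0 gf; apply: continuous_approx_ge0 => //.
    split; first exact: cmeasurable_real.
    apply: le_integrable ih => //.
      by apply/measurable_EFinP/measurable_cdot; exact: cmeasurable_real.
    move=> x _ /=; rewrite lee_fin !ger0_norm ?cdot_ge0// cdot_real -expr2.
    apply: le_trans (fh x); rewrite -[X in _ <= X](real_normK (num_real _)).
    by rewrite lerXn2r// nnegrE.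
  have -> : (fun x => (f x)%:C%C) = (fun x => (f^\+ x)%:C%C + (-1) * (f^\- x)%:C%C).
    apply/funext => x; rewrite mulN1r -rmorphB; congr (_%:C%C).
    by rewrite -{1}(funrposBneg f).
  apply: continuous_approxD; [|apply: continuous_approxM]; apply: Lp.
  - exact: measurable_funrpos.
  - by move=> x; exact: funrpos_ge0.
  - by move=> x; rewrite /funrpos ge_max normr_ge0 ler_norm.
  - exact: measurable_funrneg.
  - by move=> x; exact: funrneg_ge0.
  - by move=> x; rewrite /funrneg ge_max normr_ge0 -normrN ler_norm.
have -> : h = (fun x => (complex.Re (h x))%:C%C + 'i%C * (complex.Im (h x))%:C%C).
  by apply/funext => x; rewrite [LHS]complexE.
apply: continuous_approxD; [|apply: continuous_approxM]; apply: key => // x;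
  by rewrite /cdot -!expr2 ?lerDl ?lerDr sqr_ge0.
Qed.

End continuous_dense.

(** * The integral operator on L^2 *)

Section characters.
Context {R : realType}.

Lemma MVT_lip (f df : R -> R) (a b : R) :
  (forall x : R, is_derive x 1 f (df x)) -> (forall x : R, `|df x| <= 1) ->
  `|f a - f b| <= `|a - b|.
Proof.
move=> fdf df1; wlog ab : a b / a <= b.
  by move=> H; have [/H//|/ltW/H] := leP a b; rewrite distrC (distrC b).
have cf : {within `[a, b], continuous f}.
  by apply: derivable_within_continuous => x _; have [] := fdf x.
have [c _] := MVT_segment ab (fun x _ => fdf x) cf.
rewrite distrC (distrC a) => ->; rewrite normrM.
by rewrite ler_piMl.
Qed.

Lemma cos_lip (a b : R) : `|cos a - cos b| <= `|a - b|.
Proof.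
apply: (@MVT_lip cos (fun x => - sin x)) => x.
by rewrite normrN sin_max.
Qed.

Lemma sin_lip (a b : R) : `|sin a - sin b| <= `|a - b|.
Proof.
apply: (@MVT_lip sin cos) => x.
exact: cos_max.
Qed.

Lemma expiD (a b : R) : expi (a + b) = expi a * expi b.
Proof.
apply/eqP; rewrite eq_complex cReM cImM /= cosD sinD.
by apply/andP; split; apply/eqP; ring.
Qed.

Lemma cdot_expi (a : R) : cdot (expi a) (expi a) = 1.
Proof. by rewrite /cdot/= -!expr2 cos2Dsin2. Qed.

Variable n : nat.

Lemma measurable_dotrv (x : 'rV[R]_n) : measurable_fun setT (dotrv x).
Proof.
apply: measurable_sum => j; apply: measurable_funM => //; exact: measurable_fun_coord.
Qed.

Lemma cmeasurable_expi (x : 'rV[R]_n) :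
  cmeasurable (fun xi => expi (dotrv x xi)).
Proof.
have mx := measurable_dotrv x.
have mcos : measurable_fun setT (@cos R).
  by apply: continuous_measurable_fun; exact: continuous_cos.
have msin : measurable_fun setT (@sin R).
  by apply: continuous_measurable_fun; exact: continuous_sin.
by split; [exact: (measurableT_comp mcos mx)|exact: (measurableT_comp msin mx)].
Qed.

(** The conjugate of the character, and i times it: the real scalar products
    with them are the real and the imaginary part of T h (x), so that facts on
    L^2(mu) apply to the values of T h. *)
Definition char_re (x xi : 'rV[R]_n) : R[i] :=
  (cos (dotrv x xi) +i* (- sin (dotrv x xi)))%C.
Definition char_im (x xi : 'rV[R]_n) : R[i] :=
  (sin (dotrv x xi) +i* cos (dotrv x xi))%C.

Lemma cmeasurable_char_re x : cmeasurable (char_re x).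
Proof.
have [mc ms] := cmeasurable_expi x; split; first exact: mc.
by apply: (measurable_funN (f := fun xi => sin (dotrv x xi))).
Qed.

Lemma cmeasurable_char_im x : cmeasurable (char_im x).
Proof. by have [mc ms] := cmeasurable_expi x; split. Qed.

Lemma cdot_char_re x xi : cdot (char_re x xi) (char_re x xi) = 1.
Proof. by rewrite /cdot/= mulrNN -!expr2 cos2Dsin2. Qed.

Lemma cdot_char_im x xi : cdot (char_im x xi) (char_im x xi) = 1.
Proof. by rewrite /cdot/= -!expr2 addrC cos2Dsin2. Qed.

Lemma char_re_lip x y xi :
  cdot (char_re x xi - char_re y xi) (char_re x xi - char_re y xi) <=
  2 * dotrv (x - y) xi ^+ 2.
Proof.
rewrite /cdot cReB cImB /= -opprD mulrNN -!expr2 mulr2n mulrDl mul1r.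
have -> : dotrv (x - y) xi = dotrv x xi - dotrv y xi.
  by rewrite /dotrv -sumrB; apply: eq_bigr => j _; rewrite !mxE mulrBl.
set a := dotrv x xi; set b := dotrv y xi.
by apply: lerD; rewrite -[X in X <= _](real_normK (num_real _))
  -[X in _ <= X](real_normK (num_real _)) lerXn2r ?nnegrE// ?cos_lip ?sin_lip.
Qed.

Lemma char_im_lip x y xi :
  cdot (char_im x xi - char_im y xi) (char_im x xi - char_im y xi) <=
  2 * dotrv (x - y) xi ^+ 2.
Proof.
apply: le_trans (char_re_lip x y xi); rewrite /cdot !cReB !cImB /=; nra.
Qed.

End characters.

Section Tmu.
Context {R : realType} {n : nat}.
Variable mu : {measure set 'rV[R]_n -> \bar R}.
Hypothesis mfin : (mu setT < +oo)%E.
Hypothesis mbnd : exists2 M : R, 0 < M &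
  {ae mu, forall x : 'rV[R]_n, forall j : 'I_n, `|x 0 j| <= M}.
Implicit Types (h : 'rV[R]_n -> R[i]) (x y c : 'rV[R]_n).

Lemma L2_char_re x : L2 mu (char_re x).
Proof.
by apply: (L2_bounded mfin (cmeasurable_char_re x)) => xi; rewrite cdot_char_re.
Qed.

Lemma L2_char_im x : L2 mu (char_im x).
Proof.
by apply: (L2_bounded mfin (cmeasurable_char_im x)) => xi; rewrite cdot_char_im.
Qed.

Lemma Re_Tmu h x : complex.Re (Tmu mu h x) = dot mu (char_re x) h.
Proof. by apply: eq_Rintegral => xi _; rewrite cReM /cdot/= mulNr. Qed.

Lemma Im_Tmu h x : complex.Im (Tmu mu h x) = dot mu (char_im x) h.
Proof. by apply: eq_Rintegral => xi _; rewrite cImM /cdot/= addrC. Qed.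

Let B := fine (mu setT).

Lemma nsq_char_re x : nsq mu (char_re x) = B.
Proof.
rewrite /nsq /dot; under eq_Rintegral do rewrite cdot_char_re.
by rewrite Rintegral_cst// mul1r.
Qed.

Lemma nsq_char_im x : nsq mu (char_im x) = B.
Proof.
rewrite /nsq /dot; under eq_Rintegral do rewrite cdot_char_im.
by rewrite Rintegral_cst// mul1r.
Qed.

Lemma Tmu_bound h x : L2 mu h -> cdot (Tmu mu h x) (Tmu mu h x) <= 2 * B * nsq mu h.
Proof.
move=> Lh; rewrite /cdot Re_Tmu Im_Tmu -!expr2.
have := dot_CS (L2_char_re x) Lh; have := dot_CS (L2_char_im x) Lh.
rewrite nsq_char_re nsq_char_im; lra.
Qed.

Lemma TmuB f g x : L2 mu f -> L2 mu g ->
  Tmu mu (fun xi => f xi - g xi) x = Tmu mu f x - Tmu mu g x.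
Proof.
move=> Lf Lg; have Lr := L2_char_re x; have Li := L2_char_im x.
by apply/eqP; rewrite eq_complex cReB cImB !Re_Tmu !Im_Tmu !dotBr// !eqxx.
Qed.

Lemma TmuZ (a : R) h x : L2 mu h ->
  Tmu mu (fun xi => a%:C%C * h xi) x = a%:C%C * Tmu mu h x.
Proof.
move=> Lh; have Lr := L2_char_re x; have Li := L2_char_im x.
by apply/eqP; rewrite eq_complex cReZ cImZ !Re_Tmu !Im_Tmu !dotZr// !eqxx.
Qed.

Lemma L2_cM (a : R[i]) h : L2 mu h -> L2 mu (fun x => a * h x).
Proof. by move=> Lh; have [] := L2_cM_nsq a Lh. Qed.

Lemma Tmu_linear (a : R[i]) f g x : L2 mu f -> L2 mu g ->
  Tmu mu (fun xi => a * f xi + g xi) x = a * Tmu mu f x + Tmu mu g x.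
Proof.
move=> Lf Lg; have Lr := L2_char_re x; have Li := L2_char_im x.
(* The pairings are linear over the reals only, so multiplication by i is
   treated apart: it exchanges the two characters up to sign. *)
have iL : L2 mu (fun x => 'i%C * f x) by exact: L2_cM.
have E xi : a * f xi + g xi = (complex.Re a)%:C%C * f xi +
    (complex.Im a)%:C%C * ('i%C * f xi) + g xi.
  by rewrite {1}[a]complexE mulrDl mulrA [_ * 'i%C]mulrC.
have -> : (fun xi => a * f xi + g xi) = (fun xi => (complex.Re a)%:C%C * f xi +
    (complex.Im a)%:C%C * ('i%C * f xi) + g xi) by apply/funext => xi; exact: E.
have L1 := L2Z (complex.Re a) Lf; have L2' := L2Z (complex.Im a) iL.
have dre : dot mu (char_re x) (fun xi => 'i%C * f xi) = - dot mu (char_im x) f.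
  rewrite -[RHS]mulN1r -dotZl//; apply: eq_Rintegral => xi _.
  by rewrite cdotZl /cdot cReM cImM/=; ring.
have dim : dot mu (char_im x) (fun xi => 'i%C * f xi) = dot mu (char_re x) f.
  by apply: eq_Rintegral => xi _; rewrite /cdot cReM cImM/=; ring.
apply/eqP; rewrite eq_complex cReD cImD cReM cImM !Re_Tmu !Im_Tmu.
rewrite !dotDr ?dotZr ?dre ?dim//; [|exact: L2D|exact: L2D].
by rewrite mulrN !eqxx.
Qed.

(** The support is bounded, so characters depend on x in a Lipschitz way in
    L^2(mu), and T h inherits this with a constant proportional to |h|.  The
    uniformity in h allows pointwise convergence to be checked on a countable
    dense set. *)
Lemma Tmu_lip : exists2 C : R, 0 <= C & forall x y (e : R), 0 <= e ->
  (forall j, `|x 0 j - y 0 j| <= e) -> forall h, L2 mu h ->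
  cdot (Tmu mu h x - Tmu mu h y) (Tmu mu h x - Tmu mu h y) <= C * e ^+ 2 * nsq mu h.
Proof.
have [M M0 aeM] := mbnd.
exists (4 * (n%:R * M) ^+ 2 * B).
  by rewrite mulr_ge0 ?fine_ge0// mulr_ge0 ?sqr_ge0.
move=> x y e e0 xye h Lh.
have key (w : 'rV[R]_n -> 'rV[R]_n -> R[i]) : (forall x, L2 mu (w x)) ->
    (forall x y xi, cdot (w x xi - w y xi) (w x xi - w y xi) <= 2 * dotrv (x - y) xi ^+ 2) ->
    nsq mu (fun xi => w x xi - w y xi) <= 2 * (n%:R * M * e) ^+ 2 * B.
  move=> Lw wl; have Lwd := L2B (Lw x) (Lw y); have [mw _] := Lwd.
  rewrite -lee_fin nsqE//.
  apply: (@le_trans _ _ (\int[mu]_xi (2 * (n%:R * M * e) ^+ 2)%:E)%E); last first.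
    by rewrite integral_cst// [leRHS]EFinM /B fineK// ge0_fin_numE.
  apply: ae_ge0_le_integral => //.
  - by move=> xi _; rewrite lee_fin cdot_ge0.
  - exact/measurable_EFinP/measurable_cdot.
  - by move=> xi _; rewrite lee_fin mulr_ge0// sqr_ge0.
  - apply: filterS aeM => xi xiM _; rewrite lee_fin (le_trans (wl _ _ _))//.
    rewrite ler_wpM2l// -[X in X <= _](real_normK (num_real _)) lerXn2r ?nnegrE//.
      by rewrite -mulrA mulr_ge0// mulr_ge0// ltW.
    rewrite /dotrv (le_trans (ler_norm_sum _ _ _))//.
    apply: (@le_trans _ _ (\sum_(j < n) (M * e))).
      apply: ler_sum => j _; rewrite !mxE normrM mulrC ler_pM//.
    by rewrite sumr_const card_ord -mulrA mulr_natl.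
have Lr x := L2_char_re x; have Li x := L2_char_im x.
rewrite /cdot cReB cImB !Re_Tmu !Im_Tmu -!dotBl// -!expr2.
have h1 := dot_CS (L2B (Lr x) (Lr y)) Lh; have h2 := dot_CS (L2B (Li x) (Li y)) Lh.
apply: le_trans (lerD h1 h2) _; rewrite -mulrDl ler_wpM2r ?nsq_ge0//.
have k1 := key _ Lr (@char_re_lip R n); have k2 := key _ Li (@char_im_lip R n).
by apply: le_trans (lerD k1 k2) _; rewrite !exprMn; lra.
Qed.

Lemma Tmu_continuous h : L2 mu h ->
  continuous (fun x => complex.Re (Tmu mu h x)) /\
  continuous (fun x => complex.Im (Tmu mu h x)).
Proof.
move=> Lh; have [C C0 lip] := Tmu_lip.
have key x (e : R) : 0 < e -> \forall y \near x,
    cdot (Tmu mu h x - Tmu mu h y) (Tmu mu h x - Tmu mu h y) < e ^+ 2.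
  (* D exceeds both C |h|^2 and 1, so moving x by e / (2 D) moves T h by less
     than e. *)
  move=> e0; pose D := C * nsq mu h + 1.
  have D0 : 0 < D by rewrite ltr_wpDl// mulr_ge0// nsq_ge0.
  have D1 : 1 <= D by rewrite lerDr mulr_ge0// nsq_ge0.
  have q0 : 0 < e / (2 * D) by rewrite divr_gt0// mulr_gt0.
  near=> y; apply: (@le_lt_trans _ _ (C * (e / (2 * D)) ^+ 2 * nsq mu h)).
    apply: lip => //; first exact: ltW.
    move=> j; apply: ltW.
    have : ball x (e / (2 * D)) y by near: y; exact: nbhsx_ballx.
    by move=> [_ /(_ 0 j)].
  apply: (@le_lt_trans _ _ (D * (e / (2 * D)) ^+ 2)).
    by rewrite -mulrA [X in _ * X]mulrC mulrA ler_wpM2r ?sqr_ge0// lerDl.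
  have -> : D * (e / (2 * D)) ^+ 2 = e ^+ 2 / (4 * D) by field; rewrite gt_eqF.
  rewrite ltr_pdivrMr ?mulr_gt0// -[X in X < _]mulr1 ltr_pM2l ?exprn_gt0//; lra.
have sq (a b e : R) : 0 < e -> a ^+ 2 <= b -> b < e ^+ 2 -> `|a| < e.
  move=> e0 ab be; rewrite -(@ltr_pXn2r _ 2%N)// ?nnegrE ?ltW//.
  by rewrite real_normK ?num_real// (le_lt_trans ab).
split=> x; have FF : Filter (nbhs (x : 'rV[R]_n)) by exact: nbhs_filter.
  apply/(@cvgrPdist_lt _ _ _ _ FF) => e e0; near=> y.
  apply: (sq _ (cdot (Tmu mu h x - Tmu mu h y) (Tmu mu h x - Tmu mu h y)) _ e0).
    by rewrite -cReB /cdot -!expr2 lerDl sqr_ge0.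
  by near: y; exact: key.
apply/(@cvgrPdist_lt _ _ _ _ FF) => e e0; near=> y.
apply: (sq _ (cdot (Tmu mu h x - Tmu mu h y) (Tmu mu h x - Tmu mu h y)) _ e0).
  by rewrite -cImB /cdot -!expr2 lerDr sqr_ge0.
by near: y; exact: key.
Unshelve. all: by end_near. Qed.

Lemma cmeasurable_Tmu h : L2 mu h -> cmeasurable (Tmu mu h).
Proof.
by move=> Lh; have [cr ci] := Tmu_continuous Lh; split; exact: measurable_fun_rV_continuous.
Qed.

(** The symmetry of the problem: modulations of h are translations of T h.
    They are what may prevent a maximizing sequence from being compact. *)
Lemma Tmu_modulate c h x :
  Tmu mu (fun xi => expi (dotrv c xi) * h xi) x = Tmu mu h (x + c).
Proof.
rewrite /Tmu; congr (cintegral _ _); apply/funext => xi.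
rewrite mulrA -expiD; congr (expi _ * _).
by rewrite /dotrv -big_split/=; apply: eq_bigr => j _; rewrite mxE mulrDl.
Qed.

Lemma L2_modulate c h : L2 mu h -> L2 mu (fun xi => expi (dotrv c xi) * h xi).
Proof.
move=> [mh ih]; split; first exact/cmeasurableM/mh/cmeasurable_expi.
by under eq_fun do rewrite cdotM cdot_expi mul1r.
Qed.

Lemma nsq_modulate c h : nsq mu (fun xi => expi (dotrv c xi) * h xi) = nsq mu h.
Proof. by apply: eq_Rintegral => xi _; rewrite cdotM cdot_expi mul1r. Qed.

End Tmu.

(** * Lebesgue norms of complex functions *)

Section cLnorm_facts.
Context d (T : measurableType d) {R : realType}.
Variable m : {measure set T -> \bar R}.
Implicit Types (f g : T -> R[i]) (p : \bar R) (r : R).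
Local Notation normc := ComplexField.Normc.normc.
Local Open Scope ereal_scope.

Lemma normc_ge0 (z : R[i]) : (0 <= normc z)%R.
Proof. by rewrite normc_cdot sqrtr_ge0. Qed.

(** The r-th power of the L^r norm, which is what is additive in the limit and
    what Fatou, Brezis-Lieb and translation invariance speak of. *)
Definition energy r f : \bar R := \int[m]_x (normc (f x) `^ r)%:E.

Lemma energy_ge0 r f : 0 <= energy r f.
Proof. by apply: integral_ge0 => x _; rewrite lee_fin powR_ge0. Qed.

Lemma cLnorm_EFin r f : cLnorm m r%:E f = energy r f `^ r^-1.
Proof.
rewrite /cLnorm unlock.
by under eq_integral do rewrite abse_EFin poweR_EFin (ger0_norm (normc_ge0 _)).
Qed.

Lemma cLnorm_ge0 p f : 0 <= cLnorm m p f.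
Proof. exact: Lnorm_ge0. Qed.

Lemma energyE r f : (0 < r)%R -> energy r f = cLnorm m r%:E f `^ r.
Proof.
move=> r0; rewrite cLnorm_EFin -poweRrM mulVf ?gt_eqF// poweRe1//.
exact: energy_ge0.
Qed.

Lemma poweR_le r (x y : \bar R) : (0 < r)%R -> 0 <= x -> x <= y -> x `^ r <= y `^ r.
Proof.
move=> r0 x0 xy; apply: gt0_ler_poweR => //; first exact: ltW.
  by rewrite in_itv/= x0 leey.
by rewrite in_itv/= (le_trans x0 xy) leey.
Qed.

Lemma cLnorm_le r f (K : R) : (0 < r)%R -> (0 <= K)%R ->
  (cLnorm m r%:E f <= K%:E) = (energy r f <= (K `^ r)%:E).
Proof.
move=> r0 K0; apply/idP/idP => h.
  by rewrite energyE// -poweR_EFin; apply: poweR_le => //; exact: cLnorm_ge0.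
have -> : K%:E = (K `^ r)%:E `^ r^-1.
  by rewrite poweR_EFin -powRrM mulfV ?gt_eqF// powRr1.
by rewrite cLnorm_EFin; apply: poweR_le => //; [rewrite invr_gt0|exact: energy_ge0].
Qed.

Lemma cLnormy_le f (K : R) : (0 <= K)%R ->
  {ae m, forall x, (normc (f x) <= K)%R} -> cLnorm m +oo f <= K%:E.
Proof.
move=> K0 fK; rewrite /cLnorm unlock; case: ifPn => // _.
apply/ess_supP; apply: filterS fK => x fx /=.
by rewrite lee_fin ger0_norm// normc_ge0.
Qed.

Lemma cLnormy_ae f : 0 < m setT ->
  {ae m, forall x, (normc (f x))%:E <= cLnorm m +oo f}.
Proof.
move=> m0; rewrite /cLnorm unlock m0.
have := ess_sup_ge m (abse \o (fun x => (normc (f x))%:E)).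
by apply: filterS => x /=; rewrite ger0_norm// normc_ge0.
Qed.

Lemma eq_cLnorm_ae p f g : 0 < p -> cmeasurable f -> cmeasurable g ->
  f = g %[ae m] -> cLnorm m p f = cLnorm m p g.
Proof.
move=> p0 mf mg fg; move: p p0 => [r||//] p0.
- rewrite !cLnorm_EFin; suff -> : energy r f = energy r g by [].
  apply: ge0_ae_eq_integral => //.
  + by apply/measurable_EFinP/measurable_powR_comp/measurable_normc.
  + by apply/measurable_EFinP/measurable_powR_comp/measurable_normc.
  + by move=> x _; rewrite lee_fin powR_ge0.
  + by move=> x _; rewrite lee_fin powR_ge0.
  + by apply: filterS fg => x /[apply] ->.
- rewrite /cLnorm unlock; case: ifPn => // _.
  by apply: eq_ess_sup; apply: filterS fg => x /(_ I) /= ->.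
Qed.

Lemma normcZ (a : R) (z : R[i]) : (0 <= a)%R -> normc (a%:C%C * z)%R = (a * normc z)%R.
Proof.
move=> a0; rewrite !normc_cdot cdotZl cdotC cdotZl mulrA -expr2.
by rewrite sqrtrM ?sqr_ge0// sqrtr_sqr ger0_norm.
Qed.

Lemma cLnormZ p f (a : R) : 0 < p -> (0 < a)%R -> cmeasurable f ->
  cLnorm m p (fun x => a%:C%C * f x)%R = a%:E * cLnorm m p f.
Proof.
move=> p0 a0 mf; move: p p0 => [r||//] p0.
- rewrite !cLnorm_EFin /energy.
  under eq_integral do rewrite normcZ ?(ltW a0)// powRM ?normc_ge0 ?(ltW a0)//.
  rewrite integralZl_EFin_ge0 ?powR_ge0//; last 2 first.
  + exact/measurable_powR_comp/measurable_normc.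
  + by move=> x; exact: powR_ge0.
  rewrite poweRM ?lee_fin ?powR_ge0//; last exact: energy_ge0.
  by rewrite poweR_EFin -powRrM mulfV ?gt_eqF// powRr1// ltW.
- rewrite /cLnorm unlock; case: ifPn => [m0|_]; last by rewrite mule0.
  rewrite -ess_sup_pZl//; apply: eq_ess_sup; apply: nearW => x /=.
  by rewrite normcZ ?(ltW a0)// normrM (gtr0_norm a0).
Qed.

(** Lower semicontinuity of the norm under pointwise convergence.  For p = oo the
    bounds hold off a countable union of null sets and pass to the limit. *)
Lemma cLnorm_fatou p (f_ : nat -> T -> R[i]) f (K : R) : 0 < p -> (0 <= K)%R ->
  (forall n, cmeasurable (f_ n)) -> cmeasurable f ->
  (forall x, complex.Re (f_ n x) @[n --> \oo] --> complex.Re (f x)) ->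
  (forall x, complex.Im (f_ n x) @[n --> \oo] --> complex.Im (f x)) ->
  (\forall n \near \oo, cLnorm m p (f_ n) <= K%:E) -> cLnorm m p f <= K%:E.
Proof.
move=> p0 K0 mf_ mf cr ci nK.
have cn x : normc (f_ n x) @[n --> \oo] --> normc (f x).
  under eq_fun do rewrite normc_cdot; rewrite normc_cdot.
  apply: continuous_cvg; first exact: sqrt_continuous.
  by apply: cvgD; apply: cvgM.
move: p p0 nK => [r||//] p0 nK.
- rewrite cLnorm_le//; apply: (@fatou_le _ _ _ m (fun n x => normc (f_ n x) `^ r)%R).
  + by move=> n; exact/measurable_powR_comp/measurable_normc.
  + exact/measurable_powR_comp/measurable_normc.
  + by move=> *; exact: powR_ge0.
  + by move=> *; exact: powR_ge0.
  + apply: nearW => x; apply: cvg_powR_seq => //; first by move=> *; exact: normc_ge0.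
  + by apply: filterS nK => n; rewrite cLnorm_le.
- have [m0|] := boolP (0 < m setT); last first.
    by move=> m0; rewrite /cLnorm unlock (negbTE m0).
  apply: cLnormy_le => //.
  have [N _ NK] := nK.
  have : {ae m, forall x, forall n, (N <= n)%N -> (normc (f_ n x) <= K)%R}.
    apply: ae_foralln => n; have [Nn|nN] := leqP N n; last first.
      exact: nearW.
    apply: filterS (cLnormy_ae (f_ n) m0) => x h _.
    by rewrite -lee_fin (le_trans h)//; exact: NK.
  apply: filterS => x xK; rewrite -(cvg_lim _ (cn x))//.
  apply: limr_le; first exact: cvgP (cn x).
  by exists N.
Qed.

Lemma cLnorm_eq0_ae p f : 0 < p -> cmeasurable f -> cLnorm m p f = 0 ->
  {ae m, forall x, f x = 0%R}.
Proof.
move=> p0 mf /Lnorm_eq0_eq0 h.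
have := h _ p0; have mn : measurable_fun setT (fun x => (normc (f x))%:E).
  exact/measurable_EFinP/measurable_normc.
by move=> /(_ mn); apply: filterS => x /(_ I) [] /ComplexField.Normc.eq0_normc.
Qed.

(** The elementary interpolation inequality between L^q and L^oo. *)
Lemma energy_interpolation (q r s : R) f : (0 < q)%R -> (q < r)%R -> cmeasurable f ->
  (forall x, normc (f x) <= s)%R ->
  energy r f <= (s `^ (r - q))%:E * energy q f.
Proof.
move=> q0 qr mf fs; rewrite -integralZl_EFin_ge0 ?powR_ge0//; last 2 first.
- exact/measurable_powR_comp/measurable_normc.
- by move=> x; exact: powR_ge0.
apply: le_integral_EFin.
- exact/measurable_powR_comp/measurable_normc.
- by apply: measurable_funM => //; exact/measurable_powR_comp/measurable_normc.
- by move=> x; exact: powR_ge0.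
- move=> x; have -> : (normc (f x) `^ r = normc (f x) `^ (r - q) * normc (f x) `^ q)%R.
    by rewrite -powRD ?subrK// gt_eqF// (lt_trans q0).
  rewrite ler_wpM2r ?powR_ge0// ge0_ler_powR ?nnegrE ?normc_ge0//.
    by rewrite subr_ge0 ltW.
  exact: le_trans (normc_ge0 _) (fs x).
Qed.

End cLnorm_facts.

(** * Bounded extensions coincide with the integral operator *)

Section extension.
Context {R : realType} {n : nat}.
Variable mu : {measure set 'rV[R]_n -> \bar R}.
Hypothesis mu_radon : radon mu.
Hypothesis mu_compact : compact (msupport mu).
Implicit Types (h f g : 'rV[R]_n -> R[i]) (p : \bar R)
  (S : ('rV[R]_n -> R[i]) -> 'rV[R]_n -> R[i]).
Local Notation nu := (lebesgue_rV R n).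
Local Notation normc := ComplexField.Normc.normc.

Let mfin : (mu setT < +oo)%E := radon_finite mu_radon mu_compact.
Let mbnd := msupport_bounded mu_radon mu_compact.

(** The factor 2 comes from estimating real and imaginary part separately. *)
Definition sup_const : R := Num.sqrt (2 * fine (mu setT)).

Lemma lebesgue_rVT_gt0 : (0 < nu setT)%E.
Proof. by apply: (@lebesgue_rV_nbhs_gt0 _ _ setT 0) => //; exact: filterT. Qed.

Lemma normc_Tmu_le h x : L2 mu h ->
  normc (Tmu mu h x) <= sup_const * Num.sqrt (nsq mu h).
Proof.
move=> Lh; rewrite normc_cdot -sqrtrM; last by rewrite mulr_ge0// fine_ge0.
by rewrite ler_wsqrtr//; exact: Tmu_bound.
Qed.

Lemma normRe_le (z : R[i]) : `|complex.Re z| <= normc z.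
Proof.
rewrite normc_cdot -sqrtr_sqr ler_wsqrtr// /cdot -!expr2 lerDl sqr_ge0//.
Qed.

Lemma normIm_le (z : R[i]) : `|complex.Im z| <= normc z.
Proof.
rewrite normc_cdot -sqrtr_sqr ler_wsqrtr// /cdot -!expr2 lerDr sqr_ge0//.
Qed.

Lemma cvg_squeeze0 (u v : nat -> R) (l : R) :
  (forall k, `|l - u k| <= v k) -> v k @[k --> \oo] --> 0 -> u k @[k --> \oo] --> l.
Proof.
move=> uv /cvgr0Pnorm_lt v0; apply/cvgrPdist_lt => e e0.
apply: filterS (v0 e e0) => k; apply: le_lt_trans.
exact: le_trans (uv k) (ler_norm _).
Qed.

Lemma Tmu_cvg (k_ : nat -> 'rV[R]_n -> R[i]) h x : (forall j, L2 mu (k_ j)) -> L2 mu h ->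
  (forall j, Num.sqrt (nsq mu (fun xi => h xi - k_ j xi)) <= j.+1%:R^-1) ->
  (complex.Re (Tmu mu (k_ j) x) @[j --> \oo] --> complex.Re (Tmu mu h x)) /\
  (complex.Im (Tmu mu (k_ j) x) @[j --> \oo] --> complex.Im (Tmu mu h x)).
Proof.
move=> Lk Lh hk.
have b j : normc (Tmu mu h x - Tmu mu (k_ j) x) <= sup_const * j.+1%:R^-1.
  rewrite -(TmuB mfin)//; apply: le_trans (normc_Tmu_le _ (L2B Lh (Lk j))) _.
  by rewrite ler_wpM2l// sqrtr_ge0.
have c0 : sup_const * (j.+1%:R^-1) @[j --> \oo] --> (0 : R).
  have -> : (0 : R) = sup_const * 0 by rewrite mulr0.
  by apply: cvgMr; exact: cvg_harmonic.
split; apply: (cvg_squeeze0 _ c0) => j; apply: le_trans (b j).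
- by rewrite -cReB; exact: normRe_le.
- by rewrite -cImB; exact: normIm_le.
Qed.

Lemma near_harmonic_le (K : R) (e : R) : 0 < e ->
  \forall j \near \oo, K * j.+1%:R^-1 <= e.
Proof.
move=> e0; have c0 : K * (j.+1%:R^-1) @[j --> \oo] --> (0 : R).
  have -> : (0 : R) = K * 0 by rewrite mulr0.
  by apply: cvgMr; exact: cvg_harmonic.
by move/cvgr0Pnorm_lt : c0 => /(_ e e0); apply: filterS => j /ltW; apply: le_trans; exact: ler_norm.
Qed.

(** Approximate h in L^2(mu) by continuous k_j.  In L^p, S h - T k_j is
    S (h - k_j) up to a null function, hence small; pointwise it tends to
    S h - T h, whose L^p norm therefore vanishes by Fatou. *)
Lemma extension_ae p S : (1 <= p)%E -> bounded_extension mu p S ->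
  forall h, L2 mu h -> S h = Tmu mu h %[ae nu].
Proof.
move=> p1 [[Sfun Slin [C Sbnd]] Scont] h Lh.
have p0 : (0 < p)%E by exact: lt_le_trans p1.
have /choice[k_ k_P] j : exists k, [/\ L2 mu k, continuous_on_support mu k &
    Num.sqrt (nsq mu (fun xi => h xi - k xi)) <= j.+1%:R^-1].
  have [_ /(_ (j.+1%:R^-1 ^+ 2))[]] := continuous_dense_L2 mu_radon mfin Lh.
    by rewrite exprn_gt0// invr_gt0.
  move=> k [Lk kr ki hk]; exists k; split => //.
    by split; exact: continuous_subspaceT.
  by rewrite -[leRHS]ger0_norm ?invr_ge0// -sqrtr_sqr ler_wsqrtr.
have Lk j : L2 mu (k_ j) by have [] := k_P j.
have hk j : Num.sqrt (nsq mu (fun xi => h xi - k_ j xi)) <= j.+1%:R^-1 by have [] := k_P j.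
have kc j : continuous_on_support mu (k_ j) by have [] := k_P j.
have LS f : L2 mu f -> cmeasurable (S f).
  by move=> /L2_cLfunP/Sfun [].
pose F j y := S h y - Tmu mu (k_ j) y.
have mT f : L2 mu f -> cmeasurable (Tmu mu f) := fun Lf => cmeasurable_Tmu mfin mbnd Lf.
have mF j : cmeasurable (F j) by apply: cmeasurableB; [exact: LS|exact: mT].
have Fb j : (cLnorm nu p (F j) <= (`|C| * j.+1%:R^-1)%:E)%E.
  have Ld : L2 mu (fun x => -1 * k_ j x + h x).
    by apply: eq_L2 (L2B Lh (Lk j)) => x; rewrite mulN1r addrC.
  have -> : cLnorm nu p (F j) = cLnorm nu p (S (fun x => -1 * k_ j x + h x)).
    apply: eq_cLnorm_ae => //; first exact: LS.
    have e1 := Slin (-1) _ _ ((L2_cLfunP _ _).1 (Lk j)) ((L2_cLfunP _ _).1 Lh).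
    have e2 := Scont _ ((L2_cLfunP _ _).1 (Lk j)) (kc j).
    apply: filterS2 e1 e2 => y e1 e2 yT; rewrite e1// /F e2//.
    by rewrite mulN1r addrC.
  apply: le_trans (Sbnd _ ((L2_cLfunP _ _).1 Ld)) _.
  rewrite cLnorm2// -EFinM lee_fin.
  rewrite (@nsq_eq _ _ _ mu _ (fun x => h x - k_ j x)); last first.
    by move=> x; rewrite mulN1r addrC.
  apply: le_trans (ler_wpM2r (sqrtr_ge0 _) (ler_norm C)) _.
  by rewrite ler_wpM2l.
have lim0 (e : R) : 0 < e -> (cLnorm nu p (fun y => S h y - Tmu mu h y)%R <= e%:E)%E.
  move=> e0; apply: (@cLnorm_fatou _ _ _ _ p F) => //; first exact: ltW.
  - by apply: cmeasurableB; [exact: LS|exact: mT].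
  - move=> y; rewrite cReB; under eq_fun do rewrite cReB.
    by apply: cvgB; [exact: cvg_cst|have [] := Tmu_cvg y Lk Lh hk].
  - move=> y; rewrite cImB; under eq_fun do rewrite cImB.
    by apply: cvgB; [exact: cvg_cst|have [] := Tmu_cvg y Lk Lh hk].
  - apply: filterS (near_harmonic_le `|C| e0) => j je.
    by apply: le_trans (Fb j) _; rewrite lee_fin.
have /cLnorm_eq0_ae : cLnorm nu p (fun y => S h y - Tmu mu h y)%R = 0%E.
  apply/eqP; rewrite eq_le cLnorm_ge0 andbT.
  by apply/lee_addgt0Pr => e e0; rewrite add0e; exact: lim0.
move=> /(_ p0 (cmeasurableB (LS _ Lh) (mT _ Lh))).
by apply: filterS => y /eqP; rewrite subr_eq0 => /eqP.
Qed.

(** The quantitative content of (RC)_p for the integral itself, on all of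
    L^2(mu). *)
Definition Tmu_bounded p (C : R) := 0 <= C /\ forall h, L2 mu h ->
  (cLnorm nu p (Tmu mu h) <= (C * Num.sqrt (nsq mu h))%:E)%E.

Lemma Tmu_bounded_of_extension p S : (1 <= p)%E -> bounded_extension mu p S ->
  exists C, Tmu_bounded p C.
Proof.
move=> p1 ext; have ae := extension_ae p1 ext.
have [[Sfun _ [C Sbnd]] _] := ext.
exists `|C|; split => // h Lh.
have p0 : (0 < p)%E by exact: lt_le_trans p1.
have mS : cmeasurable (S h) by have [] := Sfun _ ((L2_cLfunP _ _).1 Lh).
rewrite -(eq_cLnorm_ae p0 mS (cmeasurable_Tmu mfin mbnd Lh) (ae h Lh)).
apply: le_trans (Sbnd _ ((L2_cLfunP _ _).1 Lh)) _.
rewrite cLnorm2// -EFinM lee_fin; apply: ler_wpM2r; [exact: sqrtr_ge0|exact: ler_norm].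
Qed.

Lemma Tmu_bounded_y : Tmu_bounded +oo sup_const.
Proof.
split; first exact: sqrtr_ge0.
move=> h Lh; apply: cLnormy_le; first by rewrite mulr_ge0// sqrtr_ge0.
by apply: nearW => x; exact: normc_Tmu_le.
Qed.

(** The condition (RC) is inherited by larger exponents, thanks to the trivial
    bound in L^oo. *)
Lemma Tmu_bounded_interpolation (q r C : R) : 0 < q -> q < r ->
  Tmu_bounded q%:E C -> exists C', Tmu_bounded r%:E C'.
Proof.
move=> q0 qr [C0 Cb]; have r0 : 0 < r by exact: lt_trans qr.
have K0 : 0 <= sup_const by exact: sqrtr_ge0.
pose X := sup_const `^ (r - q) * C `^ q.
have X0 : 0 <= X by rewrite mulr_ge0 ?powR_ge0.
have XE : (X `^ r^-1) `^ r = X by rewrite -powRrM mulVf ?gt_eqF// powRr1.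
exists (X `^ r^-1); split; first exact: powR_ge0.
move=> h Lh; have mT := cmeasurable_Tmu mfin mbnd Lh.
have N0 : 0 <= Num.sqrt (nsq mu h) by exact: sqrtr_ge0.
rewrite cLnorm_le ?mulr_ge0 ?powR_ge0//.
apply: le_trans (energy_interpolation _ q0 qr mT (fun x => normc_Tmu_le x Lh)) _.
have := Cb h Lh; rewrite cLnorm_le ?mulr_ge0// => Eq.
apply: (@le_trans _ _ (((sup_const * Num.sqrt (nsq mu h)) `^ (r - q))%:E *
   ((C * Num.sqrt (nsq mu h)) `^ q)%:E)%E).
  by apply: lee_wpmul2l => //; rewrite lee_fin powR_ge0.
have rq : (Num.sqrt (nsq mu h)) `^ (r - q) * (Num.sqrt (nsq mu h)) `^ q =
    (Num.sqrt (nsq mu h)) `^ r by rewrite -powRD ?subrK// gt_eqF.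
rewrite -EFinM lee_fin [leRHS]powRM ?powR_ge0// XE -rq.
by rewrite (powRM (r - q) K0 N0) (powRM q C0 N0) mulrACA.
Qed.

Lemma bounded_extension_Tmu p C : (1 <= p)%E -> Tmu_bounded p C ->
  bounded_extension mu p (Tmu mu).
Proof.
move=> p1 [C0 Cb]; split; last by move=> h _ _; exact: nearW.
have b f : cLfun mu 2%:E f -> (cLnorm nu p (Tmu mu f) <= C%:E * cLnorm mu 2%:E f)%E.
  by move=> /L2_cLfunP Lf; rewrite cLnorm2// -EFinM; exact: Cb.
split.
- move=> f Lf; split; first exact: (cmeasurable_Tmu mfin mbnd ((L2_cLfunP _ _).2 Lf)).
  apply: le_lt_trans (b f Lf) _; rewrite cLnorm2 -?EFinM ?ltry//; exact/L2_cLfunP.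
- move=> a f g /L2_cLfunP Lf /L2_cLfunP Lg; apply: nearW => y _.
  exact: (Tmu_linear mfin).
- by exists C.
Qed.

End extension.

(** * Weak limits along an ultrafilter *)

Section ultrafilter.
Context {R : realType}.
Variable U : set_system nat.
Hypothesis UU : UltraFilter U.
Hypothesis U_oo : \oo `<=` U.

(** The image ultrafilter lives on a compact interval. *)
Lemma ultra_bounded_cvg (u : nat -> R) (K : R) : (forall k, `|u k| <= K) -> cvg (u @ U).
Proof.
move=> uK; have := @segment_compact R (- K) K.
rewrite compact_ultra => /(_ (u @ U) _)[].
- split; first exact: fmap_proper_filter.
  move=> G PG UG; apply/seteqP; split => A; last exact: UG.
  move=> GA; have [//|nUA] := pselect ((u @ U) A).
  have : U (~` (u @^-1` A)) by have [] := in_ultra_setVsetC (u @^-1` A) UU.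
  move=> UC; have : G (~` A) by apply: UG.
  have FG : Filter G by case: PG.
  move=> GC; have := @filterI _ _ FG _ _ GA GC; rewrite setICr => G0.
  by have [x []] := @filter_ex _ _ PG _ G0.
- by apply: nearW => k /=; rewrite in_itv/= -ler_norml.
- by move=> l [_ ul]; apply/cvg_ex; exists l.
Qed.

(** An ultrafilter refining the cofinite filter meets every condition at
    arbitrarily large indices, so countably many conditions can be met along
    one strictly increasing sequence. *)
Lemma ultra_extract (P : nat -> nat -> Prop) :
  (forall j, \forall k \near U, P j k) ->
  exists2 psi : nat -> nat, {homo psi : j k / (j < k)%N} & forall j, P j (psi j).
Proof.
move=> UP; have FU : ProperFilter U by exact: ultra_proper.
have /choice[F FP] (jN : nat * nat) : exists k, (jN.2 < k)%N /\ P jN.1 k.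
  have UN : \forall k \near U, (jN.2 < k)%N by apply: U_oo; exists jN.2.+1.
  have [k [h1 h2]] := @filter_ex _ _ FU _ (filterI UN (UP jN.1)).
  by exists k.
pose psi := fix psi j := if j is j'.+1 then F (j, psi j') else F (0%N, 0%N).
exists psi.
  apply: homo_ltn => [y x z|j]; first exact: ltn_trans.
  by rewrite /=; have [] := FP (j.+1, psi j).
case=> [|j] /=; first by have [] := FP (0%N, 0%N).
by have [] := FP (j.+1, psi j).
Qed.

End ultrafilter.

Section weak_limit.
Context d (T : measurableType d) {R : realType}.
Variable m : {measure set T -> \bar R}.
Hypothesis mfin : (m setT < +oo)%E.
Variable U : set_system nat.
Hypothesis UU : UltraFilter U.

(** Weak compactness of the unit ball: the pairings converge along the
    ultrafilter for all f simultaneously, and their limit is a bounded linear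
    functional. *)
Lemma weak_ultralimit (g_ : nat -> T -> R[i]) :
  (forall k, L2 m (g_ k)) -> (forall k, nsq m (g_ k) <= 1) ->
  exists2 g, L2 m g & forall f, L2 m f -> dot m (g_ k) f @[k --> U] --> dot m g f.
Proof.
move=> Lg g1; have FU : ProperFilter U by exact: ultra_proper.
have bnd f k : L2 m f -> dot m (g_ k) f ^+ 2 <= nsq m f.
  move=> Lf; apply: le_trans (dot_CS (Lg k) Lf) _.
  by rewrite ler_piMl// nsq_ge0.
have cv f : L2 m f -> cvg (dot m (g_ k) f @[k --> U]).
  move=> Lf; apply: (@ultra_bounded_cvg R U UU (fun k => dot m (g_ k) f) (nsq m f + 1)) => k.
  have := bnd f k Lf; have := nsq_ge0 m f; set b := dot _ _ _.
  rewrite -(real_normK (num_real b)) expr2; have := normr_ge0 b; nra.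
pose L f := lim (dot m (g_ k) f @[k --> U]).
have LL f : L2 m f -> dot m (g_ k) f @[k --> U] --> L f by exact: cv.
have [|||g Lgg gE] := @riesz_L2 _ _ _ m mfin L.
- move=> f1 f2 L1 L2; apply: cvg_lim => //.
  under eq_fun do rewrite dotDr//.
  by apply: cvgD; exact: LL.
- move=> a f Lf; apply: cvg_lim => //.
  under eq_fun do rewrite dotZr//.
  by apply: cvgMr; exact: LL.
- move=> f Lf.
  have : dot m (g_ k) f ^+ 2 @[k --> U] --> L f ^+ 2.
    by under eq_fun do rewrite expr2; rewrite expr2; apply: cvgM; exact: LL.
  move=> h; rewrite -(cvg_lim _ h)//; apply: limr_le; first exact: cvgP h.
  by apply: nearW => k; exact: bnd.
by exists g => // f Lf; rewrite -gE//; exact: LL.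
Qed.

(** Pythagoras in the limit: the cross term of |g_k - g|^2 tends to
    -2 |g|^2. *)
Lemma weak_limit_nsq (g_ : nat -> T -> R[i]) g :
  (forall k, L2 m (g_ k)) -> (forall k, nsq m (g_ k) = 1) -> L2 m g ->
  (forall f, L2 m f -> dot m (g_ k) f @[k --> U] --> dot m g f) ->
  nsq m g <= 1 /\
  nsq m (fun x => g_ k x - g x) @[k --> U] --> 1 - nsq m g.
Proof.
move=> Lg g1 Lgg gw; have FU : ProperFilter U by exact: ultra_proper.
have cg := gw g Lgg.
have cn : nsq m (fun x => g_ k x - g x) @[k --> U] --> 1 - nsq m g.
  under eq_fun do rewrite nsqB// g1.
  have -> : 1 - nsq m g = 1 - 2 * dot m g g + nsq m g by rewrite -/(nsq m g); ring.
  apply: cvgD; last exact: cvg_cst.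
  apply: cvgB; first exact: cvg_cst.
  exact: cvgMr.
split=> //; rewrite -subr_ge0 -(cvg_lim _ cn)//; apply: limr_ge; first exact: cvgP cn.
by apply: nearW => k; exact: nsq_ge0.
Qed.

End weak_limit.

(** * Mass does not split *)

Section two_powers.
Context {R : realType}.

Lemma powR_lt_sqr (s r : R) : 0 < s -> s < 1 -> 2 < r -> s `^ r < s ^+ 2.
Proof.
move=> s0 s1 r2; rewrite -powR_mulrn ?ltW// -[r](subrK 2) powRD; last first.
  by rewrite (gt_eqF s0) implybT.
rewrite -[ltRHS]mul1r ltr_pM2r ?powR_gt0//.
have h : s `^ (r - 2) < 1 `^ (r - 2).
  by apply: gt0_ltr_powR; rewrite ?subr_gt0 ?nnegrE ?ltW.
by rewrite powR1 in h.
Qed.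

(** With s = sqrt a and t = sqrt (1 - a) one has s^r + t^r < s^2 + t^2 = 1 as
    soon as 0 < a < 1, because r > 2: two separated pieces are less efficient
    than a single one. *)
Lemma no_splitting (a r M E : R) : 2 < r -> 0 < M -> 0 < a -> a <= 1 ->
  E <= (M * Num.sqrt a) `^ r ->
  (forall e, 0 < e -> M `^ r <= (1 + e) * (M * Num.sqrt (1 - a)) `^ r + E) ->
  a = 1 /\ M `^ r <= E.
Proof.
move=> r2 M0 a0 a1 Ea H.
have r0 : r != 0 by rewrite gt_eqF//; lra.
have a1' : a = 1.
  apply/eqP; rewrite eq_le a1 leNgt; apply/negP => alt.
  have sa0 : 0 < Num.sqrt a by rewrite sqrtr_gt0.
  have sb0 : 0 < Num.sqrt (1 - a) by rewrite sqrtr_gt0 subr_gt0.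
  have s1 (t : R) : t < 1 -> Num.sqrt t < 1.
    by move=> t1; rewrite -[ltRHS]sqrtr1 ltr_sqrt.
  have pa := powR_lt_sqr sa0 (s1 _ alt) r2.
  have pb : Num.sqrt (1 - a) `^ r < Num.sqrt (1 - a) ^+ 2.
    by apply: powR_lt_sqr => //; apply: s1; lra.
  rewrite !sqr_sqrtr ?subr_ge0 ?(ltW a0)// in pa pb.
  have Mr0 : 0 < M `^ r by exact: powR_gt0.
  have pb0 : 0 < Num.sqrt (1 - a) `^ r by exact: powR_gt0.
  (* For this e the first term on the right of H equals M^r (1 - a). *)
  pose e := (1 - a) / Num.sqrt (1 - a) `^ r - 1.
  have e0 : 0 < e by rewrite subr_gt0 ltr_pdivlMr// mul1r.
  have := H e e0; move: Ea; rewrite !powRM ?sqrtr_ge0 ?(ltW M0)// => Ea.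
  have -> : (1 + e) * (M `^ r * Num.sqrt (1 - a) `^ r) = M `^ r * (1 - a).
    by rewrite /e; field; rewrite gt_eqF.
  have : M `^ r * Num.sqrt a `^ r < M `^ r * a by rewrite ltr_pM2l.
  lra.
split=> //; have := H 1 ltr01; rewrite a1' subrr sqrtr0 mulr0 powR0//; lra.
Qed.

End two_powers.

(** * Pointwise convergence and suprema of T h *)

Section subsequences.

Lemma incr_ge (f : nat -> nat) : {homo f : j k / (j < k)%N} -> forall k, (k <= f k)%N.
Proof. by move=> fi; elim=> // k IH; apply: leq_ltn_trans IH _; exact: fi. Qed.

Lemma cvg_incr (f : nat -> nat) : {homo f : j k / (j < k)%N} -> f k @[k --> \oo] --> \oo.
Proof.
move=> fi A [N _ NA]; exists N => // k /= Nk; apply: NA => /=.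
exact: leq_trans Nk (incr_ge fi k).
Qed.

End subsequences.

Section Tmu_limits.
Context {R : realType} {n : nat}.
Variable mu : {measure set 'rV[R]_n -> \bar R}.
Hypothesis mu_radon : radon mu.
Hypothesis mu_compact : compact (msupport mu).
Implicit Types (h f g : 'rV[R]_n -> R[i]) (p : \bar R) (x y : 'rV[R]_n).
Local Notation nu := (lebesgue_rV R n).
Local Notation normc := ComplexField.Normc.normc.

Let mfin : (mu setT < +oo)%E := radon_finite mu_radon mu_compact.
Let mbnd := msupport_bounded mu_radon mu_compact.

Lemma normc_opp (z : R[i]) : normc (- z) = normc z.
Proof. by rewrite !normc_cdot /cdot; case: z => a b /=; rewrite !mulrNN. Qed.

Lemma normc_distC (z w : R[i]) : normc (z - w) = normc (w - z).
Proof. by rewrite -normc_opp opprB. Qed.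

Lemma normcB_le (z w : R[i]) : normc z <= normc (z - w) + normc w.
Proof. by apply: le_trans (le_normcD _ _); rewrite subrK. Qed.

Lemma normc_Tmu_lip : exists2 K : R, 0 <= K & forall x y (e : R), 0 <= e ->
  (forall j, `|x 0 j - y 0 j| <= e) -> forall h, L2 mu h -> nsq mu h <= 1 ->
  normc (Tmu mu h x - Tmu mu h y) <= K * e.
Proof.
have [C C0 lip] := Tmu_lip mfin mbnd; exists (Num.sqrt C); first exact: sqrtr_ge0.
move=> x y e e0 xy h Lh h1; rewrite normc_cdot -[e]ger0_norm// -sqrtr_sqr -sqrtrM//.
rewrite ler_wsqrtr// (le_trans (lip _ _ _ e0 xy _ Lh))//.
by rewrite -[leRHS]mulr1 ler_wpM2l// mulr_ge0// sqr_ge0.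
Qed.

Lemma normc_Tmu_continuous h : L2 mu h -> nsq mu h <= 1 ->
  continuous (fun x => normc (Tmu mu h x)).
Proof.
move=> Lh h1 x; have [K K0 lip] := normc_Tmu_lip.
have FF : Filter (nbhs (x : 'rV[R]_n)) by exact: nbhs_filter.
apply/(@cvgrPdist_lt _ _ _ _ FF) => e e0.
have q0 : 0 < e / (K + 1) by rewrite divr_gt0// ltr_wpDl.
near=> y; have xy : normc (Tmu mu h x - Tmu mu h y) <= K * (e / (K + 1)).
  apply: lip => //; first exact: ltW.
  move=> j; apply: ltW.
  have : ball x (e / (K + 1)) y by near: y; exact: nbhsx_ballx.
  by move=> [_ /(_ 0 j)].
have Ke : K * (e / (K + 1)) < e.
  by rewrite mulrCA gtr_pMr// ltr_pdivrMr ?ltr_wpDl// mul1r ltrDl.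
have := normcB_le (Tmu mu h x) (Tmu mu h y).
have := normcB_le (Tmu mu h y) (Tmu mu h x); rewrite (normc_distC (Tmu mu h y)).
by move=> h2 h3; rewrite ltr_norml; apply/andP; split; lra.
Unshelve. all: by end_near. Qed.

(** Evaluation of T h at a point is a weakly continuous functional of h. *)
Lemma Tmu_weak_cvg (U : set_system nat) (FU : ProperFilter U) (g_ : nat -> 'rV[R]_n -> R[i]) g :
  (forall f, L2 mu f -> dot mu (g_ k) f @[k --> U] --> dot mu g f) ->
  forall x, normc (Tmu mu (g_ k) x - Tmu mu g x) @[k --> U] --> 0.
Proof.
move=> gw x.
have z f : L2 mu f -> dot mu (g_ k) f - dot mu g f @[k --> U] --> (0 : R).
  by move=> Lf; rewrite -(subrr (dot mu g f)); apply: cvgB; [exact: gw|exact: cvg_cst].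
have h0 : cdot (Tmu mu (g_ k) x - Tmu mu g x) (Tmu mu (g_ k) x - Tmu mu g x)
    @[k --> U] --> (0 * 0 + 0 * 0 : R).
  rewrite /cdot; under eq_fun do
    rewrite cReB cImB !Re_Tmu !Im_Tmu !(dotC mu (char_re x)) !(dotC mu (char_im x)).
  by apply: cvgD; apply: cvgM; apply: z; [exact: L2_char_re|exact: L2_char_re|
    exact: L2_char_im|exact: L2_char_im].
have hs : Num.sqrt (cdot (Tmu mu (g_ k) x - Tmu mu g x) (Tmu mu (g_ k) x - Tmu mu g x))
    @[k --> U] --> Num.sqrt (0 * 0 + 0 * 0 : R).
  by apply: continuous_cvg; [exact: sqrt_continuous|exact: h0].
rewrite mul0r addr0 sqrtr0 in hs.
by under eq_fun do rewrite normc_cdot.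
Qed.

Lemma rat_row_near x (e : R) : 0 < e ->
  exists q : 'rV[rat]_n, forall j, `|x 0 j - (map_mx ratr q : 'rV[R]_n) 0 j| <= e.
Proof.
move=> e0; have /choice[c cP] j : exists q : rat, `|x 0 j - ratr q| <= e.
  have /rat_in_itvoo[q /itvP qP] : x 0 j - e < x 0 j + e by lra.
  have q1 : x 0 j - e < ratr q by rewrite qP.
  have q2 : ratr q < x 0 j + e by rewrite qP.
  by exists q; rewrite ler_norml; apply/andP; split; lra.
by exists (\row_j c j) => j; rewrite !mxE.
Qed.

(** The functions T f_j are equi-Lipschitz, so convergence at rational points
    implies convergence at all points. *)
Lemma Tmu_cvg_everywhere (f_ : nat -> 'rV[R]_n -> R[i]) g :
  (forall j, L2 mu (f_ j)) -> (forall j, nsq mu (f_ j) <= 1) -> L2 mu g -> nsq mu g <= 1 ->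
  (forall q : 'rV[rat]_n, normc (Tmu mu (f_ j) (map_mx ratr q) - Tmu mu g (map_mx ratr q))
     @[j --> \oo] --> 0) ->
  forall x, normc (Tmu mu (f_ j) x - Tmu mu g x) @[j --> \oo] --> 0.
Proof.
move=> Lf f1 Lg g1 H x; have [K K0 lip] := normc_Tmu_lip.
apply/cvgr0Pnorm_lt => e e0; pose e' := e / (3 * (K + 1)).
have K1 : 0 < K + 1 by rewrite ltr_wpDl.
have e'0 : 0 < e' by rewrite divr_gt0// mulr_gt0.
have [q xq] := rat_row_near x e'0.
have Ke : K * e' <= e / 3.
  have -> : K * e' = e / 3 * (K / (K + 1)) by rewrite /e'; field; rewrite gt_eqF.
  rewrite -[leRHS]mulr1 ler_wpM2l//; first by rewrite divr_ge0// ltW.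
  by rewrite ler_pdivrMr// mul1r lerDl.
have e3 : 0 < e / 3 by rewrite divr_gt0.
move/cvgr0Pnorm_lt : (H q) => /(_ _ e3); apply: filterS => j.
rewrite !ger0_norm ?normc_ge0//.
set y := map_mx ratr q => hq.
have h1 := lip _ _ _ (ltW e'0) xq _ (Lf j) (f1 j).
have h2 := lip _ _ _ (ltW e'0) xq _ Lg g1.
have -> : Tmu mu (f_ j) x - Tmu mu g x = (Tmu mu (f_ j) x - Tmu mu (f_ j) y) +
    (Tmu mu (f_ j) y - Tmu mu g y) + (Tmu mu g y - Tmu mu g x) by ring.
have h3 := le_normcD (Tmu mu (f_ j) x - Tmu mu (f_ j) y + (Tmu mu (f_ j) y - Tmu mu g y))
  (Tmu mu g y - Tmu mu g x).
have h4 := le_normcD (Tmu mu (f_ j) x - Tmu mu (f_ j) y) (Tmu mu (f_ j) y - Tmu mu g y).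
rewrite (normc_distC (Tmu mu g y)) in h3.
lra.
Qed.

Lemma energy_translate r (F : 'rV[R]_n -> R[i]) (c : 'rV[R]_n) : cmeasurable F ->
  energy nu r (fun x => F (x + c)) = energy nu r F.
Proof.
move=> mF; apply: (integral_translate c (f := fun x => (normc (F x) `^ r)%:E)).
  exact/measurable_EFinP/measurable_powR_comp/measurable_normc.
by move=> x; rewrite lee_fin powR_ge0.
Qed.

Definition Tsup h : R := sup (range (fun x => normc (Tmu mu h x))).

Lemma has_Tsup h : L2 mu h -> has_sup (range (fun x => normc (Tmu mu h x))).
Proof.
move=> Lh; split; first by exists (normc (Tmu mu h 0)), 0.
exists (sup_const mu * Num.sqrt (nsq mu h)) => _ [x _ <-].
exact: (normc_Tmu_le mu_radon mu_compact x Lh).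
Qed.

Lemma Tmu_le_Tsup h x : L2 mu h -> normc (Tmu mu h x) <= Tsup h.
Proof. by move=> Lh; apply: sup_upper_bound; [exact: has_Tsup|exists x]. Qed.

Lemma Tsup_adherent h (e : R) : L2 mu h -> 0 < e -> exists x, Tsup h - e < normc (Tmu mu h x).
Proof.
move=> Lh e0; have [_ [x _ <-] xe] := sup_adherent e0 (has_Tsup Lh).
by exists x.
Qed.

Lemma Tsup_ge0 h : L2 mu h -> 0 <= Tsup h.
Proof. by move=> Lh; apply: le_trans (Tmu_le_Tsup 0 Lh); exact: normc_ge0. Qed.

(** By continuity of T h the essential supremum is a bound at every point. *)
Lemma normc_Tmu_le_Lnormy h x : L2 mu h -> nsq mu h <= 1 ->
  ((normc (Tmu mu h x))%:E <= cLnorm nu +oo (Tmu mu h))%E.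
Proof.
move=> Lh h1; have [_ b] := Tmu_bounded_y mu_radon mu_compact.
have Bfin : cLnorm nu +oo (Tmu mu h) \is a fin_num.
  by rewrite ge0_fin_numE ?cLnorm_ge0// (le_lt_trans (b h Lh)) ?ltry.
have mT := cmeasurable_Tmu mfin mbnd Lh.
rewrite -[leRHS]fineK// lee_fin -subr_le0.
apply: (@continuous_le0_of_ae _ _ (fun y => normc (Tmu mu h y) - fine (cLnorm nu +oo (Tmu mu h)))).
- by apply: measurable_funB => //; exact: measurable_normc.
- apply: continuousB; last exact: cst_continuous.
  exact: normc_Tmu_continuous.
- apply: filterS (cLnormy_ae (Tmu mu h) (@lebesgue_rVT_gt0 R n)) => y.
  by rewrite -[X in (_ <= X)%E]fineK// lee_fin subr_le0.
Qed.

End Tmu_limits.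

(** * The weak limit carries all the mass *)

Section concentration_compactness.
Context {R : realType} {n : nat}.
Variable mu : {measure set 'rV[R]_n -> \bar R}.
Hypothesis mu_radon : radon mu.
Hypothesis mu_compact : compact (msupport mu).
Implicit Types (h f g : 'rV[R]_n -> R[i]) (p : \bar R) (x y : 'rV[R]_n).
Local Notation nu := (lebesgue_rV R n).
Local Notation normc := ComplexField.Normc.normc.

Let mfin : (mu setT < +oo)%E := radon_finite mu_radon mu_compact.
Let mbnd := msupport_bounded mu_radon mu_compact.
Let mT h (Lh : L2 mu h) := cmeasurable_Tmu mfin mbnd Lh.

Definition sharp_bound p (M : R) := forall h, L2 mu h ->
  (cLnorm nu p (Tmu mu h) <= (M * Num.sqrt (nsq mu h))%:E)%E.

Lemma energy_fin (r M : R) h : 0 < r -> 0 <= M -> sharp_bound r%:E M -> L2 mu h ->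
  exists2 E : R, energy nu r (Tmu mu h) = E%:E & E <= (M * Num.sqrt (nsq mu h)) `^ r.
Proof.
move=> r0 M0 Mb Lh; have := Mb h Lh.
rewrite cLnorm_le ?mulr_ge0 ?sqrtr_ge0// => Eb.
have Efin : energy nu r (Tmu mu h) \is a fin_num.
  by rewrite ge0_fin_numE ?energy_ge0// (le_lt_trans Eb) ?ltry.
by exists (fine (energy nu r (Tmu mu h))); rewrite ?fineK// -lee_fin fineK.
Qed.

(** Brezis-Lieb needs a sequence and pointwise convergence, so the ultrafilter is
    first traded for a subsequence along which T g_k converges at all rational
    points and |g_k - g|^2 converges.  In the limit M^r is at most the sum of
    the contributions of g_k - g and of g, each controlled by M and its L^2
    norm, and [no_splitting] applies. *)
Lemma weak_limit_full (r M : R) (U : set_system nat) (g_ : nat -> 'rV[R]_n -> R[i]) g :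
  2 < r -> 0 < M -> sharp_bound r%:E M ->
  UltraFilter U -> \oo `<=` U ->
  (forall k, L2 mu (g_ k)) -> (forall k, nsq mu (g_ k) = 1) -> L2 mu g ->
  (forall f, L2 mu f -> dot mu (g_ k) f @[k --> U] --> dot mu g f) ->
  cLnorm nu r%:E (Tmu mu (g_ k)) @[k --> \oo] --> M%:E ->
  0 < nsq mu g ->
  nsq mu g = 1 /\ (M%:E <= cLnorm nu r%:E (Tmu mu g))%E.
Proof.
move=> r2 M0 Mb UU oU Lg g1 Lgg gw gM gpos.
have FU : ProperFilter U by exact: ultra_proper.
have r0 : 0 < r by lra.
have [gle1 gn] := weak_limit_nsq UU Lg g1 Lgg gw.
have ratpt := Tmu_weak_cvg mu_radon mu_compact FU gw.
(* At stage j only the rational points with code at most j are controlled,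
   which makes the j-th condition a finite one. *)
pose P (j k : nat) := `|1 - nsq mu g - nsq mu (fun x => g_ k x - g x)| < j.+1%:R^-1 /\
  forall i : 'I_j.+1, forall q : 'rV[rat]_n, unpickle i = Some q ->
    normc (Tmu mu (g_ k) (map_mx ratr q) - Tmu mu g (map_mx ratr q)) < j.+1%:R^-1.
have [j|psi psi_incr psiP] := @ultra_extract U UU oU P.
  have j0 : 0 < j.+1%:R^-1 :> R by rewrite invr_gt0.
  apply: filterI; first by move/cvgrPdist_lt : gn; apply.
  apply: filter_forall => i; case: (unpickle i) => [q|]; last exact: nearW.
  have /cvgr0Pnorm_lt /(_ _ j0) := ratpt (map_mx ratr q).
  by apply: filterS => k hk q' [<-]; apply: le_lt_trans hk; exact: ler_norm.
pose f_ j := g_ (psi j).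
have inv0 : (j.+1%:R^-1 : R) @[j --> \oo] --> 0 by exact: cvg_harmonic.
have fn : nsq mu (fun x => f_ j x - g x) @[j --> \oo] --> 1 - nsq mu g.
  by apply: (cvg_squeeze0 _ inv0) => j; have [/ltW] := psiP j.
have fpt x : normc (Tmu mu (f_ j) x - Tmu mu g x) @[j --> \oo] --> 0.
  apply: (Tmu_cvg_everywhere mu_radon mu_compact) => //.
  - by move=> j; exact: Lg.
  - by move=> j; rewrite g1.
  move=> q; apply/cvgr0Pnorm_lt => e e0.
  move/cvgr0Pnorm_lt : inv0 => /(_ _ e0) [N _ NP].
  exists (maxn N (pickle q)) => // j /=; rewrite geq_max => /andP[Nj qj].
  rewrite ger0_norm ?normc_ge0//; have [_ H] := psiP j.
  have qj1 : (pickle q < j.+1)%N by [].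
  apply: lt_trans (H (Ordinal qj1) q _) _; first by rewrite /= pickleK.
  by apply: le_lt_trans (NP j Nj); exact: ler_norm.
have [E EE Eb] := energy_fin r0 (ltW M0) Mb Lgg.
pose a j := fine (cLnorm nu r%:E (Tmu mu (f_ j))).
have afin j : cLnorm nu r%:E (Tmu mu (f_ j)) = (a j)%:E.
  rewrite fineK// ge0_fin_numE ?cLnorm_ge0//.
  by apply: le_lt_trans (Mb _ (Lg _)) (ltry _).
have a0 j : 0 <= a j by rewrite -lee_fin -afin cLnorm_ge0.
have aM : a j @[j --> \oo] --> M.
  have : cLnorm nu r%:E (Tmu mu (f_ j)) @[j --> \oo] --> M%:E.
    exact: (cvg_comp _ _ (cvg_incr psi_incr) gM).
  exact: fine_cvg.
have [b bE bb] : exists2 b : nat -> R,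
    (forall j, \int[nu]_x (normc (Tmu mu (f_ j) x - Tmu mu g x) `^ r)%:E = (b j)%:E)%E &
    forall j, b j <= (M * Num.sqrt (nsq mu (fun x => f_ j x - g x))) `^ r.
  have /choice[b bP] j : exists b : R,
      (\int[nu]_x (normc (Tmu mu (f_ j) x - Tmu mu g x) `^ r)%:E = b%:E)%E /\
      b <= (M * Num.sqrt (nsq mu (fun x => f_ j x - g x))) `^ r.
    have [b bE bb] := energy_fin r0 (ltW M0) Mb (L2B (Lg (psi j)) Lgg).
    have TB : Tmu mu (fun x => f_ j x - g x) = (fun x => Tmu mu (f_ j) x - Tmu mu g x).
      by apply/funext => x; rewrite (TmuB mfin x (Lg (psi j)) Lgg).
    by exists b; split; [rewrite TB in bE; exact: bE|exact: bb].
  by exists b => j; have [] := bP j.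
have mf j : cmeasurable (Tmu mu (f_ j)) := mT (Lg (psi j)).
have mg : cmeasurable (Tmu mu g) := mT Lgg.
have mfg j : cmeasurable (fun x => Tmu mu (f_ j) x - Tmu mu g x) := cmeasurableB (mf j) mg.
have BL (e : R) : 0 < e -> exists2 w : nat -> R, w j @[j --> \oo] --> 0 &
    forall j, a j `^ r <= (1 + e) * b j + E + w j.
  move=> e0.
  have Efin : (\int[nu]_x (normc (Tmu mu g x) `^ r)%:E < +oo)%E.
    by rewrite -[X in (X < _)%E]/(energy nu r (Tmu mu g)) EE ltry.
  have vua j x : normc (Tmu mu g x) <=
      normc (Tmu mu (f_ j) x) + normc (Tmu mu (f_ j) x - Tmu mu g x).
    by rewrite addrC normc_distC; exact: normcB_le.
  have [w w0 wP] := brezis_lieb_le r0 e0 (fun j => measurable_normc (mf j))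
    (fun j => measurable_normc (mfg j)) (measurable_normc mg)
    (fun j x => normc_ge0 _) (fun j x => normc_ge0 _) (fun x => normc_ge0 _)
    (fun j x => normcB_le (Tmu mu (f_ j) x) (Tmu mu g x))
    vua fpt Efin.
  exists w => // j; have := wP j; rewrite bE -[X in (X <= _)%E]/(energy nu r (Tmu mu (f_ j))).
  rewrite -[X in (_ + X + _)%E]/(energy nu r (Tmu mu g)) EE energyE// afin poweR_EFin.
  by rewrite -EFinM -!EFinD lee_fin.
have limit (e : R) : 0 < e -> M `^ r <= (1 + e) * (M * Num.sqrt (1 - nsq mu g)) `^ r + E.
  move=> e0; have [w w0 wP] := BL e e0.
  have cu : a j `^ r @[j --> \oo] --> M `^ r by exact: cvg_powR_seq.
  have cs : M * Num.sqrt (nsq mu (fun x => f_ j x - g x)) @[j --> \oo] -->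
      M * Num.sqrt (1 - nsq mu g).
    by apply: cvgMr; apply: continuous_cvg; [exact: sqrt_continuous|exact: fn].
  have cv : (1 + e) * (M * Num.sqrt (nsq mu (fun x => f_ j x - g x))) `^ r + E + w j
      @[j --> \oo] --> (1 + e) * (M * Num.sqrt (1 - nsq mu g)) `^ r + E + 0.
    apply: cvgD w0; apply: cvgD; last exact: cvg_cst.
    apply: cvgMr; apply: cvg_powR_seq => // j.
    by rewrite mulr_ge0 ?sqrtr_ge0// ltW.
  rewrite -[leRHS]addr0 -(cvg_lim _ cu)// -(cvg_lim _ cv)//.
  apply: ler_lim; [exact: cvgP cu|exact: cvgP cv|].
  apply: nearW => j; apply: le_trans (wP j) _.
  have e1 : 0 <= 1 + e by lra.
  exact: (lerD (lerD (ler_wpM2l e1 (bb j)) (lexx E)) (lexx (w j))).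
have [-> ME] := no_splitting r2 M0 gpos gle1 Eb limit.
split=> //; have -> : M%:E = ((M `^ r)%:E `^ r^-1)%E.
  by rewrite poweR_EFin -powRrM mulfV ?gt_eqF// powRr1// ltW.
rewrite cLnorm_EFin EE; apply: poweR_le; rewrite ?invr_gt0 ?lee_fin//.
exact: powR_ge0.
Qed.

End concentration_compactness.

(** * Concentration of maximizing sequences *)

Section maximizing.
Context {R : realType} {n : nat}.
Variable mu : {measure set 'rV[R]_n -> \bar R}.
Hypothesis mu_radon : radon mu.
Hypothesis mu_compact : compact (msupport mu).
Implicit Types (h f g : 'rV[R]_n -> R[i]) (p : \bar R) (x y : 'rV[R]_n).
Local Notation nu := (lebesgue_rV R n).
Local Notation normc := ComplexField.Normc.normc.

Let mfin : (mu setT < +oo)%E := radon_finite mu_radon mu_compact.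
Let mbnd := msupport_bounded mu_radon mu_compact.
Let mT h (Lh : L2 mu h) := cmeasurable_Tmu mfin mbnd Lh.

Definition modulate (c : 'rV[R]_n) h : 'rV[R]_n -> R[i] :=
  fun xi => expi (dotrv c xi) * h xi.

Lemma cvge_near_gt (u : nat -> \bar R) (l c : R) :
  u k @[k --> \oo] --> l%:E -> c < l -> \forall k \near \oo, (c%:E < u k)%E.
Proof.
move=> /fine_cvgP[ufin ul] cl; apply: filterS2 ufin (cvgr_gt l ul c cl) => k uk h.
by rewrite -[u k]fineK// lte_fin.
Qed.

(** What p > max (2, p_0) provides.  In L^oo the supremum of |T h| is the norm
    to be maximised and needs no comparison with an L^q norm. *)
Definition supercritical p := p = +oo%E \/ exists r q C : R,
  [/\ p = r%:E, 2 < r, 0 < q, q < r & Tmu_bounded mu q%:E C].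

(** Vanishing is excluded: as q < r, the energy of exponent r is at most
    (sup |T h|)^(r-q) times a bounded energy of exponent q, so it would tend to
    0 together with the supremum. *)
Lemma Tsup_lower_bound (r q C M : R) (h_ : nat -> 'rV[R]_n -> R[i]) :
  0 < q -> q < r -> Tmu_bounded mu q%:E C -> 0 < M ->
  (forall k, L2 mu (h_ k)) -> (forall k, nsq mu (h_ k) = 1) ->
  cLnorm nu r%:E (Tmu mu (h_ k)) @[k --> \oo] --> M%:E ->
  exists2 c : R, 0 < c & \forall k \near \oo, c <= Tsup mu (h_ k).
Proof.
move=> q0 qr [C0 Cb] M0 Lh h1 hM; have r0 : 0 < r by exact: lt_trans qr.
have rq : 0 < r - q by rewrite subr_gt0.
have K0 : 0 < C `^ q + 1 by rewrite ltr_wpDl// powR_ge0.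
(* If (sup |T h_k|)^(r-q) < X, the energy is below (M/2)^r; adding 1 avoids a
   division by 0. *)
pose X := (M / 2) `^ r / (C `^ q + 1).
have M2 : 0 < M / 2 by lra.
have X0 : 0 < X by rewrite divr_gt0// powR_gt0.
exists (X `^ (r - q)^-1); first exact: powR_gt0.
have : \forall k \near \oo, ((M / 2)%:E < cLnorm nu r%:E (Tmu mu (h_ k)))%E.
  apply: (cvge_near_gt hM); lra.
apply: filterS => k hk; rewrite leNgt; apply/negP => lt.
have s0 := Tsup_ge0 mu_radon mu_compact (Lh k).
have h2 := energy_interpolation nu q0 qr (mT (Lh k))
  (fun x => Tmu_le_Tsup mu_radon mu_compact x (Lh k)).
have := Cb _ (Lh k); rewrite h1 sqrtr1 mulr1 cLnorm_le// => h3.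
have h4 : (energy nu r (Tmu mu (h_ k)) <= (Tsup mu (h_ k) `^ (r - q) * C `^ q)%:E)%E.
  by apply: le_trans h2 _; rewrite EFinM; apply: lee_wpmul2l => //; rewrite lee_fin powR_ge0.
have h5 : (((M / 2) `^ r)%:E <= energy nu r (Tmu mu (h_ k)))%E.
  rewrite energyE// -poweR_EFin; apply: poweR_le => //; last exact: ltW.
  by rewrite lee_fin ltW.
have := le_trans h5 h4; rewrite lee_fin => h6.
have h7 : Tsup mu (h_ k) `^ (r - q) <= X.
  have -> : X = (X `^ (r - q)^-1) `^ (r - q).
    by rewrite -powRrM mulVf ?gt_eqF// powRr1// ltW.
  by apply: ge0_ler_powR; rewrite ?nnegrE ?powR_ge0 ?(ltW rq)// ltW.
have h8 : X * (C `^ q + 1) = (M / 2) `^ r by rewrite divfK// gt_eqF.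
have h9 := ler_wpM2r (powR_ge0 C q) h7.
have h10 : X * C `^ q < X * (C `^ q + 1) by rewrite ltr_pM2l// ltrDl.
by have := le_lt_trans (le_trans h6 h9) h10; rewrite h8 ltxx.
Qed.

(** The points x_k are chosen before the subsequence: h_k is modulated so that
    its image is nearly maximal at the origin, which keeps T g (0) away from 0
    for every weak limit g of every subsequence. *)
Lemma concentration p (M : R) (h_ : nat -> 'rV[R]_n -> R[i]) :
  supercritical p -> 0 < M -> sharp_bound mu p M ->
  (forall k, L2 mu (h_ k)) -> (forall k, nsq mu (h_ k) = 1) ->
  cLnorm nu p (Tmu mu (h_ k)) @[k --> \oo] --> M%:E ->
  exists x_ : nat -> 'rV[R]_n, forall phi : nat -> nat,
    {homo phi : j k / (j < k)%N} ->
    exists2 psi : nat -> nat, {homo psi : j k / (j < k)%N} &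
    exists g, [/\ L2 mu g, nsq mu g = 1, cLnorm nu p (Tmu mu g) = M%:E &
      nsq mu (fun xi => modulate (x_ (phi (psi k))) (h_ (phi (psi k))) xi - g xi)
        @[k --> \oo] --> 0].
Proof.
move=> crit M0 Mb Lh h1 hM.
have /choice[x_ xP] k : exists x, Tsup mu (h_ k) - k.+1%:R^-1 < normc (Tmu mu (h_ k) x).
  by apply: Tsup_adherent => //; rewrite invr_gt0.
exists x_ => phi phi_incr.
have [U [UU oU]] := @ultraFilterLemma nat \oo _.
have FU : ProperFilter U by exact: ultra_proper.
pose g_ k := modulate (x_ (phi k)) (h_ (phi k)).
have Lg k : L2 mu (g_ k) by exact: L2_modulate.
have g1 k : nsq mu (g_ k) = 1 by rewrite nsq_modulate.
have TgE k : Tmu mu (g_ k) = (fun x => Tmu mu (h_ (phi k)) (x + x_ (phi k))).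
  by apply/funext => x; exact: Tmu_modulate.
have g1' k : nsq mu (g_ k) <= 1 by rewrite g1.
have [g Lgg gw] := weak_ultralimit mfin UU Lg g1'.
have [gle1 gn] := weak_limit_nsq UU Lg g1 Lgg gw.
have g0 := Tmu_weak_cvg mu_radon mu_compact FU gw 0.
(* The phase has been chosen so that T g_k (0) is within 1/k of the supremum;
   pass to the limit along the ultrafilter. *)
have lowb (c : R) : (\forall k \near \oo, c <= Tsup mu (h_ k)) -> c <= normc (Tmu mu g 0).
  move=> [N _ Nc]; apply/ler_addgt0Pr => e e0.
  have e2 : 0 < e / 2 by rewrite divr_gt0.
  have near1 : \forall k \near U, normc (Tmu mu (g_ k) 0 - Tmu mu g 0) < e / 2.
    move/cvgr0Pnorm_lt : g0 => /(_ _ e2); apply: filterS => k; apply: le_lt_trans.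
    exact: ler_norm.
  have near2 : \forall k \near U, (N <= k)%N by apply: oU; exists N.
  have near3 : \forall k \near U, k.+1%:R^-1 < e / 2.
    apply: oU; have inv0 : (k.+1%:R^-1 : R) @[k --> \oo] --> 0 by exact: cvg_harmonic.
    move/cvgr0Pnorm_lt : inv0 => /(_ _ e2); apply: filterS => k; apply: le_lt_trans.
    exact: ler_norm.
  have [k [[k1 k2] k3]] := @filter_ex _ _ FU _ (filterI (filterI near1 near2) near3).
  have kphi := incr_ge phi_incr k.
  have h2 := Nc (phi k) (leq_trans k2 kphi).
  have h3 := xP (phi k).
  have h4 : (phi k).+1%:R^-1 <= k.+1%:R^-1 :> R by rewrite lef_pV2 ?posrE// ler_nat.
  have h5 := normcB_le (Tmu mu (g_ k) 0) (Tmu mu g 0).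
  have h6 : Tmu mu (g_ k) 0 = Tmu mu (h_ (phi k)) (x_ (phi k)) by rewrite TgE add0r.
  rewrite -h6 in h3.
  have L (a b t i j z q : R) : c <= t -> t - i < a -> i <= j -> a <= b + z ->
    b < q / 2 -> j < q / 2 -> c <= z + q by lra.
  exact: (L _ _ _ _ _ _ _ h2 h3 h4 h5 k1 k3).
suff [a1 Mg] : nsq mu g = 1 /\ (M%:E <= cLnorm nu p (Tmu mu g))%E.
  have [psi psi_incr psiP] : exists2 psi : nat -> nat, {homo psi : j k / (j < k)%N} &
      forall j, nsq mu (fun x => g_ (psi j) x - g x) < j.+1%:R^-1.
    apply: (@ultra_extract U UU oU (fun j k => nsq mu (fun x => g_ k x - g x) < j.+1%:R^-1)).
    move=> j; rewrite a1 subrr in gn.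
    have j0 : 0 < j.+1%:R^-1 :> R by rewrite invr_gt0.
    move/cvgr0Pnorm_lt : gn => /(_ _ j0); apply: filterS => k; apply: le_lt_trans.
    exact: ler_norm.
  exists psi => //; exists g; split => //.
    by apply/eqP; rewrite eq_le Mg andbT; have := Mb g Lgg; rewrite a1 sqrtr1 mulr1.
  have inv0 : (k.+1%:R^-1 : R) @[k --> \oo] --> 0 by exact: cvg_harmonic.
  apply: (cvg_squeeze0 _ inv0) => k.
  by rewrite sub0r normrN ger0_norm ?nsq_ge0//; apply/ltW/psiP.
case: crit => [py|[r [q [C [pr r2 q0 qr Cb]]]]].
- subst p.
  have M_le : M <= normc (Tmu mu g 0).
    apply/ler_addgt0Pr => e e0; rewrite -lerBlDr; apply: lowb.
    have : \forall k \near \oo, ((M - e)%:E < cLnorm nu +oo (Tmu mu (h_ k)))%E.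
      by apply: (cvge_near_gt hM); rewrite ltrBlDr ltrDl.
    apply: filterS => k hk; rewrite -lee_fin; apply: le_trans (ltW hk) _.
    apply: cLnormy_le; first exact: Tsup_ge0.
    by apply: nearW => x; exact: Tmu_le_Tsup.
  have h2 := normc_Tmu_le_Lnormy mu_radon mu_compact 0 Lgg gle1.
  have h3 : (M%:E <= cLnorm nu +oo (Tmu mu g))%E by apply: le_trans h2; rewrite lee_fin.
  split=> //; apply/eqP; rewrite eq_le gle1/=.
  have := le_trans h3 (Mb g Lgg); rewrite lee_fin -[leLHS]mulr1 ler_pM2l// => h4.
  by rewrite -[leRHS]sqr_sqrtr ?nsq_ge0// -(expr1n _ 2) lerXn2r// ?nnegrE ?sqrtr_ge0.
- subst p; apply: (weak_limit_full mu_radon mu_compact r2 M0 Mb UU oU Lg g1 Lgg gw).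
    have r0 : 0 < r by lra.
    have E k : cLnorm nu r%:E (Tmu mu (g_ k)) = cLnorm nu r%:E (Tmu mu (h_ (phi k))).
      by rewrite !cLnorm_EFin TgE energy_translate//; exact: mT.
    under eq_fun do rewrite E.
    exact: (cvg_comp _ _ (cvg_incr phi_incr) hM).
  have [c c0 cs] := Tsup_lower_bound q0 qr Cb M0 Lh h1 hM.
  have := lt_le_trans c0 (le_trans (lowb c cs) (normc_Tmu_le mu_radon mu_compact 0 Lgg)).
  move=> H; rewrite lt_neqAle nsq_ge0 andbT eq_sym; apply/eqP => g_0.
  by move: H; rewrite g_0 sqrtr0 mulr0 ltxx.
Qed.

End maximizing.

(** * The operator norm *)

Section operator_norm.
Context {R : realType} {n : nat}.
Variable mu : {measure set 'rV[R]_n -> \bar R}.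
Hypothesis mu_radon : radon mu.
Hypothesis mu_compact : compact (msupport mu).
Hypothesis mu_neq0 : mu setT <> 0%E.
Implicit Types (h f g : 'rV[R]_n -> R[i]) (p : \bar R).
Local Notation nu := (lebesgue_rV R n).
Local Notation normc := ComplexField.Normc.normc.

Let mfin : (mu setT < +oo)%E := radon_finite mu_radon mu_compact.
Let mbnd := msupport_bounded mu_radon mu_compact.
Let mT h (Lh : L2 mu h) := cmeasurable_Tmu mfin mbnd Lh.

Lemma cLnorm2_nsq f (a : R) : L2 mu f -> 0 <= a ->
  (cLnorm mu 2%:E f = a%:E) <-> nsq mu f = a ^+ 2.
Proof.
move=> Lf a0; rewrite cLnorm2//; split => [[<-]|->].
  by rewrite sqr_sqrtr// nsq_ge0.
by rewrite sqrtr_sqr ger0_norm.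
Qed.

(** The image of a constant function is continuous and its value at the origin
    is a multiple of the total mass, so that T does not vanish. *)
Lemma Tmu_neq0 p : (0 < p)%E -> exists h, [/\ L2 mu h, nsq mu h = 1 &
  (0 < cLnorm nu p (Tmu mu h))%E].
Proof.
move=> p0; set B := fine (mu setT).
have B0 : 0 < B.
  by rewrite fine_gt0// mfin andbT lt_neqAle measure_ge0 andbT eq_sym; apply/eqP.
pose c := char_re (0 : 'rV[R]_n); have Lc : L2 mu c by exact: L2_char_re.
pose a := (Num.sqrt B)^-1; have a0 : 0 < a by rewrite invr_gt0 sqrtr_gt0.
pose h xi := a%:C%C * c xi; have Lh : L2 mu h by exact: L2Z.
have h1 : nsq mu h = 1.
  rewrite nsqZ// nsq_char_re -/B exprVn sqr_sqrtr ?(ltW B0)//.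
  by rewrite mulVf// gt_eqF.
exists h; split=> //; rewrite lt_neqAle cLnorm_ge0 andbT eq_sym; apply/eqP => T0.
have ae0 := cLnorm_eq0_ae p0 (mT Lh) T0.
have : normc (Tmu mu h 0) <= 0.
  apply: (@continuous_le0_of_ae _ _ (fun x => normc (Tmu mu h x))).
  - exact/measurable_normc/mT.
  - by apply: normc_Tmu_continuous => //; rewrite h1.
  - by apply: filterS ae0 => x ->; rewrite normc_cdot /cdot/= mul0r addr0 sqrtr0.
apply/negP; rewrite -ltNge; apply: lt_le_trans (normRe_le _).
rewrite Re_Tmu dotZr// normr_gt0 mulf_neq0//; first by rewrite gt_eqF.
by rewrite -/(nsq mu c) nsq_char_re gt_eqF.
Qed.

Lemma L2_normalize h : L2 mu h -> 0 < nsq mu h ->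
  L2 mu (fun xi => ((Num.sqrt (nsq mu h))^-1)%:C%C * h xi) /\
  nsq mu (fun xi => ((Num.sqrt (nsq mu h))^-1)%:C%C * h xi) = 1.
Proof.
move=> Lh h0; split; first exact: L2Z.
by rewrite nsqZ// exprVn sqr_sqrtr ?(ltW h0)// mulVf// gt_eqF.
Qed.

Lemma cLnorm_TmuZ p (a : R) h : (0 < p)%E -> 0 < a -> L2 mu h ->
  cLnorm nu p (Tmu mu (fun xi => a%:C%C * h xi)) = (a%:E * cLnorm nu p (Tmu mu h))%E.
Proof.
move=> p0 a0 Lh; rewrite -(cLnormZ _ p0 a0 (mT Lh)).
by congr cLnorm; apply/funext => x; exact: TmuZ.
Qed.

(** Replaces the abstract norm of S by a sharp constant for the integral
    operator, finite and positive. *)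
Lemma opnorm_sharp p S : (1 <= p)%E -> bounded_extension mu p S ->
  exists2 M : R, Tnorm mu p S = M%:E & 0 < M /\ sharp_bound mu p M.
Proof.
move=> p1 ext; have p0 : (0 < p)%E by exact: lt_le_trans p1.
have aeS := extension_ae mu_radon mu_compact p1 ext.
have [C [C0 Cb]] := Tmu_bounded_of_extension mu_radon mu_compact p1 ext.
have [[Sfun _ _] _] := ext.
have SE f : L2 mu f -> cLnorm nu p (S f) = cLnorm nu p (Tmu mu f).
  move=> Lf; apply: eq_cLnorm_ae => //; [|exact: mT|exact: aeS].
  by have [] := Sfun _ ((L2_cLfunP _ _).1 Lf).
have le1 f : L2 mu f -> nsq mu f <= 1 -> (cLnorm nu p (Tmu mu f) <= Tnorm mu p S)%E.
  move=> Lf f1; apply: ereal_sup_ubound; exists f; last exact: SE.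
  split; first exact/L2_cLfunP.
  by rewrite cLnorm2// lee_fin -[leRHS]sqrtr1 ler_wsqrtr.
have leC : (Tnorm mu p S <= C%:E)%E.
  apply: ge_ereal_sup => _ [f [/L2_cLfunP Lf f1] <-]; rewrite SE//.
  apply: le_trans (Cb f Lf) _; rewrite lee_fin ler_piMr//.
  by move: f1; rewrite cLnorm2// lee_fin.
have [h [Lh h1 hpos]] := Tmu_neq0 p0.
have Tpos : (0 < Tnorm mu p S)%E by apply: lt_le_trans hpos (le1 h Lh _); rewrite h1.
have Tfin : Tnorm mu p S \is a fin_num.
  by rewrite ge0_fin_numE ?(ltW Tpos)// (le_lt_trans leC) ?ltry.
exists (fine (Tnorm mu p S)); first by rewrite fineK.
split; first by rewrite -lte_fin fineK.
move=> f Lf; have := nsq_ge0 mu f; rewrite le_eqVlt => /predU1P[f0|f0].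
  by have := Cb f Lf; rewrite -f0 sqrtr0 !mulr0.
have [Ln n1] := L2_normalize Lf f0.
have s0 : 0 < Num.sqrt (nsq mu f) by rewrite sqrtr_gt0.
have := le1 _ Ln; rewrite n1 lexx => /(_ isT).
rewrite cLnorm_TmuZ ?invr_gt0// => h3.
rewrite EFinM fineK//.
have h4 := lee_wpmul2r (_ : (0 <= (Num.sqrt (nsq mu f))%:E)%E) h3.
apply: le_trans (h4 _); last by rewrite lee_fin ltW.
by rewrite muleAC -EFinM mulVf ?gt_eqF// mul1e.
Qed.

Lemma exists_maximizing_seq p (M : R) S : (1 <= p)%E -> bounded_extension mu p S ->
  Tnorm mu p S = M%:E -> 0 < M -> sharp_bound mu p M ->
  exists h_ : nat -> 'rV[R]_n -> R[i], [/\ forall k, L2 mu (h_ k),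
    forall k, nsq mu (h_ k) = 1 &
    cLnorm nu p (Tmu mu (h_ k)) @[k --> \oo] --> M%:E].
Proof.
move=> p1 ext TM M0 Mb; have p0 : (0 < p)%E by exact: lt_le_trans p1.
have aeS := extension_ae mu_radon mu_compact p1 ext.
have [[Sfun _ _] _] := ext.
(* The supremum defining the norm runs over the unit ball.  The error
   M / (k + 2) is less than M, so near-optimal vectors are nonzero and may be
   normalised, which only increases the image. *)
have /choice[h_ hP] k : exists h, [/\ L2 mu h, nsq mu h = 1 &
    ((M - M * k.+2%:R^-1)%:E < cLnorm nu p (Tmu mu h))%E].
  have e0 : 0 < M * k.+2%:R^-1 by rewrite mulr_gt0// invr_gt0.
  have fin : Tnorm mu p S \is a fin_num by rewrite TM.
  have [_ [f [/L2_cLfunP Lf f1] <-]] := ub_ereal_sup_adherent e0 fin.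
  rewrite [X in (X - _)%E](_ : _ = M%:E); last exact: TM.
  have -> : cLnorm nu p (S f) = cLnorm nu p (Tmu mu f).
    apply: eq_cLnorm_ae => //; [|exact: mT|exact: aeS].
    by have [] := Sfun _ ((L2_cLfunP _ _).1 Lf).
  rewrite -EFinB => hf.
  have Mk : 0 < M - M * k.+2%:R^-1.
    by rewrite subr_gt0 gtr_pMr// invf_lt1// ltr1n.
  have s0 : 0 < Num.sqrt (nsq mu f).
    have := lt_le_trans hf (Mb f Lf); rewrite lte_fin => /(lt_trans Mk).
    by rewrite pmulr_rgt0.
  have n0 : 0 < nsq mu f by rewrite -sqrtr_gt0.
  have [Ln n1] := L2_normalize Lf n0.
  exists (fun xi => ((Num.sqrt (nsq mu f))^-1)%:C%C * f xi); split => //.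
  rewrite cLnorm_TmuZ ?invr_gt0//; apply: lt_le_trans hf _.
  rewrite -[leLHS]mul1e; apply: lee_wpmul2r; first exact: cLnorm_ge0.
  rewrite lee_fin invf_ge1//.
  by move: f1; rewrite cLnorm2// lee_fin.
exists h_; split; [by move=> k; have [] := hP k|by move=> k; have [] := hP k|].
have upper k : (cLnorm nu p (Tmu mu (h_ k)) <= M%:E)%E.
  have [Lh h1 _] := hP k; have := Mb _ Lh; rewrite h1 sqrtr1 mulr1//.
apply: (@squeeze_cvge _ _ _ _ (fun k => (M - M * k.+2%:R^-1)%:E) _ (fun=> M%:E)).
- by apply: nearW => k; rewrite upper andbT ltW//; have [] := hP k.
- have inv0 : (k.+2%:R^-1 : R) @[k --> \oo] --> 0.
    by apply: (cvg_comp _ _ (cvg_incr (f := succn) _) cvg_harmonic).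
  have : M - M * k.+2%:R^-1 @[k --> \oo] --> M - M * 0.
    by apply: cvgB; [exact: cvg_cst|exact: cvgMr].
  by rewrite mulr0 subr0; exact: cvg_EFin_seq.
- exact: cvg_cst.
Qed.

End operator_norm.

Theorem theorem0p1 (R : realType) (d : nat)
    (mu : {measure set 'rV[R]_d -> \bar R})
    (mu_radon : radon mu)
    (mu_compact : compact (msupport mu))
    (mu_neq0 : mu setT <> 0%E)
    (p : \bar R)
    (p_gt : (maxe 2%:E (critical_exponent mu) < p)%E) :
  restriction_condition mu p /\
  forall S : ('rV[R]_d -> R[i]) -> ('rV[R]_d -> R[i]),
    bounded_extension mu p S ->
    (exists h, maximizer mu p S h) /\
    (forall h_ : nat -> 'rV[R]_d -> R[i], maximizing_seq mu p S h_ ->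
      exists x_ : nat -> 'rV[R]_d,
        relatively_compact_seq mu 2%:E
          (fun n xi => expi (dotrv (x_ n) xi) * h_ n xi)).
Proof.
move: p_gt; rewrite gt_max => /andP[p2 pc].
have p1 : (1 <= p)%E by apply: le_trans (ltW p2); rewrite lee_fin ler1n.
have p0 : (0 < p)%E by exact: lt_le_trans p1.
have [crit [C CT]] : supercritical mu p /\ exists C, Tmu_bounded mu p C.
  have [q [q1 [S0 ext0]] qp] := ereal_inf_lt pc.
  have [C CT] := Tmu_bounded_of_extension mu_radon mu_compact q1 ext0.
  move: p p2 qp {pc p1 p0} => [r| |//] p2 qp; last first.
    split; first by left.
    by exists (sup_const mu); exact: Tmu_bounded_y.
  move: q q1 qp ext0 CT => [q| |//] q1 qp ext0 CT; last first.
    by move: qp; rewrite ltNge leey.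
  have q0 : 0 < q by rewrite -lte_fin (lt_le_trans _ q1).
  split; first by right; exists r, q, C; split.
  exact: (Tmu_bounded_interpolation mu_radon mu_compact q0 qp CT).
split.
  by exists (Tmu mu); exact: (bounded_extension_Tmu mu_radon mu_compact p1 CT).
move=> S ext.
have [M TM [M0 Mb]] := opnorm_sharp mu_radon mu_compact mu_neq0 p1 ext.
have aeS := extension_ae mu_radon mu_compact p1 ext.
have mfin := radon_finite mu_radon mu_compact.
have mbnd := msupport_bounded mu_radon mu_compact.
have SE f : L2 mu f -> cLnorm (lebesgue_rV R d) p (S f) = cLnorm (lebesgue_rV R d) p (Tmu mu f).
  move=> Lf; apply: eq_cLnorm_ae => //; [|exact: (cmeasurable_Tmu mfin mbnd Lf)|exact: aeS].
  by have [[Sfun _ _] _] := ext; have [] := Sfun _ ((L2_cLfunP _ _).1 Lf).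
split.
- have [h_ [Lh h1 hM]] := exists_maximizing_seq mu_radon mu_compact p1 ext TM M0 Mb.
  have [x_ xP] := concentration mu_radon mu_compact crit M0 Mb Lh h1 hM.
  have [psi _ [g [Lg g1 gM _]]] := xP id (fun j k jk => jk).
  exists g; split; first exact/L2_cLfunP.
    by rewrite cLnorm2// g1 sqrtr1.
  by rewrite SE// gM TM.
- move=> h_ [h_P hM].
  have Lh k : L2 mu (h_ k) by have [/L2_cLfunP] := h_P k.
  have h1 k : nsq mu (h_ k) = 1.
    have [_ h1] := h_P k; rewrite -(expr1n _ 2).
    by apply/(cLnorm2_nsq (Lh k)).
  have hM' : cLnorm (lebesgue_rV R d) p (Tmu mu (h_ k)) @[k --> \oo] --> M%:E.
    by rewrite -TM; under eq_fun do rewrite -SE//.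
  have [x_ xP] := concentration mu_radon mu_compact crit M0 Mb Lh h1 hM'.
  exists x_ => phi phi_incr.
  have [psi psi_incr [g [Lg _ _ gcvg]]] := xP phi phi_incr.
  exists psi => //; exists g; first exact/L2_cLfunP.
  have Ld k : L2 mu (fun x => modulate (x_ (phi (psi k))) (h_ (phi (psi k))) x - g x).
    by apply: L2B => //; exact: L2_modulate.
  rewrite (_ : (fun k => _) = (fun k => (Num.sqrt (nsq mu (fun x =>
      modulate (x_ (phi (psi k))) (h_ (phi (psi k))) x - g x)))%:E)); last first.
    by apply/funext => k; rewrite -cLnorm2.
  apply: cvg_EFin_seq; rewrite -(sqrtr0 R); apply: continuous_cvg => //.
  exact: sqrt_continuous.
Qed.
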